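(* In the $\ell_2$-$\ell_1$ setup, let $\alpha,L>0$, let $w_0\in\mathcal{Z}$, let $g:\mathcal{Z}\to\mathcal{Z}^*$ be monotone and $L$-Lipschitz (i.e. $\|g(z)-g(z')\|_*\le L\|z-z'\|$), and let $\tilde g_{w_0}$ be a $(w_0,L,\frac{24L^2}{\alpha})$-CBB gradient estimator for $g$. Let $\eta=\frac{\alpha}{24L^2}$ and let $T$ be an integer with $T\ge\frac{4}{\eta\alpha}=\frac{96L^2}{\alpha^2}$. Then the iterates $$w_t=\operatorname*{arg\,min}_{w\in\mathcal{Z}}\Big\{\langle\tilde g_{w_0}(w_{t-1}),w\rangle+\tfrac{\alpha}{2}V_{w_0}(w)+\tfrac1\eta V_{w_{t-1}}(w)\Big\},\qquad t=1,\dots,T,$$ satisfy $$\mathbb{E}\max_{u\in\mathcal{Z}}\left[\frac1T\sum_{t=1}^T\langle g(w_t),w_t-u\rangle-\alpha V_{w_0}(u)\right]\le0.$$ Moreover, if $g(z)=(A^\top z^{\mathsf y},-Az^{\mathsf x})$ for a matrix $A\in\mathbb{R}^{m\times n}$, then $\mathcal{O}(w_0)=\bar w_T=\frac1T\sum_{t=1}^Tw_t$ is an $(\alpha,0)$-relaxed proximal oracle for $g$, i.e. $$\mathbb{E}\Big[\max_{u\in\mathcal{Z}}\big\{\langle g(\bar w_T),\bar w_T-u\rangle-\alpha V_{w_0}(u)\big\}\Big]\le0.$$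
   Context: $\ell_2$-$\ell_1$ setup: $\mathcal{X}=\mathbb{B}^n=\{x\in\mathbb{R}^n:\|x\|_2\le1\}$, $\mathcal{Y}=\Delta^m=\{y\in\mathbb{R}^m:y\ge0,\|y\|_1=1\}$, $\mathcal{Z}=\mathcal{X}\times\mathcal{Y}$; for $z\in\mathbb{R}^n\times\mathbb{R}^m$, $z^{\mathsf x},z^{\mathsf y}$ are the first $n$ and last $m$ coordinates. Norm $\|z\|^2=\|z^{\mathsf x}\|_2^2+\|z^{\mathsf y}\|_1^2$, dual norm $\|\gamma\|_*^2=\|\gamma^{\mathsf x}\|_2^2+\|\gamma^{\mathsf y}\|_\infty^2$. The distance generating function is $r(z)=\frac12\|z^{\mathsf x}\|_2^2+\sum_i[z^{\mathsf y}]_i\log[z^{\mathsf y}]_i$, with Bregman divergence $V_z(z')=\frac12\|z^{\mathsf x}-z'^{\mathsf x}\|_2^2+\sum_{i\in[m]}[z'^{\mathsf y}]_i\log\frac{[z'^{\mathsf y}]_i}{[z^{\mathsf y}]_i}$ (with $0\log0=0$, and value $+\infty$ if $[z^{\mathsf y}]_i=0<[z'^{\mathsf y}]_i$ for some $i$). $g$ is monotone if $\langle g(z')-g(z),z'-z\rangle\ge0$ for all $z,z'\in\mathcal{Z}$. For $w_0\in\mathcal{Z}$ and $\tau,L>0$, a stochastic estimator $\tilde g_{w_0}:\mathcal{Z}\to\mathcal{Z}^*$ is $(w_0,L,\tau)$-centered-bounded-biased (CBB) for $g$ if for all $w\in\mathcal{Z}$: (1) $\mathbb{E}\tilde g^{\mathsf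 x}_{w_0}(w)=g^{\mathsf x}(w)$ and $\|\mathbb{E}\tilde g^{\mathsf y}_{w_0}(w)-g^{\mathsf y}(w)\|_\infty\le\frac{L^2}{\tau}\|w-w_0\|^2$; (2) $\|\tilde g^{\mathsf y}_{w_0}(w)-g^{\mathsf y}(w_0)\|_\infty\le\tau$; (3) $\mathbb{E}\|\tilde g^{\mathsf x}_{w_0}(w)-g^{\mathsf x}(w_0)\|_2^2+\max_{i\in[m]}\mathbb{E}[\tilde g^{\mathsf y}_{w_0}(w)-g^{\mathsf y}(w_0)]_i^2\le L^2\|w-w_0\|^2$. Each evaluation uses fresh randomness, independent of everything before. An $(\alpha,\varepsilon)$-relaxed proximal oracle for $g$ is a (possibly randomized) map $\mathcal{O}:\mathcal{Z}\to\mathcal{Z}$ such that $z'=\mathcal{O}(z)$ satisfies $\mathbb{E}[\max_{u\in\mathcal{Z}}\{\langle g(z'),z'-u\rangle-\alpha V_z(u)\}]\le\varepsilon$. *)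

(* Defs.v *)
From HB Require Import structures.
From mathcomp Require Import all_boot all_order all_algebra.
From mathcomp Require Import all_classical all_reals all_analysis.

Set Implicit Arguments.
Unset Strict Implicit.
Unset Printing Implicit Defensive.

Import Order.TTheory GRing.Theory Num.Theory.
Import numFieldNormedType.Exports.

Local Open Scope classical_set_scope.
Local Open Scope ring_scope.

(** Column vectors carry the sigma-algebra generated by their coordinates,
    i.e. the Borel sigma-algebra of R^k (the library only provides it for
    tuples). *)
Definition cV_display : measure_display.
Proof. exact: default_measure_display. Qed.

Section measurable_cV.
Context {R : realType} {k : nat}.

Definition cV_coord (i : 'I_k) (x : 'cV[R]_k) : R := x i 0.

Let cV_set0 : g_sigma_preimage cV_coord set0.
Proof. exact: sigma_algebra0. Qed.

Let cV_setC A : g_sigma_preimage cV_coord A -> g_sigma_preimage cV_coord (~` A).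
Proof. exact: sigma_algebraC. Qed.

Let cV_bigcup (F : (set 'cV[R]_k)^nat) :
  (forall i, g_sigma_preimage cV_coord (F i)) ->
  g_sigma_preimage cV_coord (\bigcup_i (F i)).
Proof. exact: sigma_algebra_bigcup. Qed.

HB.instance Definition _ := @isMeasurable.Build cV_display
  'cV[R]_k (g_sigma_preimage cV_coord) cV_set0 cV_setC cV_bigcup.

End measurable_cV.

(** The ambient space R^n x R^m, also used for its dual; [z.1] and [z.2] are
    the x- and y-blocks of [z]. *)
Notation zspace R n m := ('cV[R]_n * 'cV[R]_m)%type.

Section geometry.
Context {R : realType}.

Definition dot k (x y : 'cV[R]_k) : R := \sum_i x i 0 * y i 0.
Definition l2norm k (x : 'cV[R]_k) : R := Num.sqrt (\sum_i x i 0 ^+ 2).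
Definition l1norm k (x : 'cV[R]_k) : R := \sum_i `|x i 0|.
(** The norm of the library on matrices is the maximum of the absolute values
    of the entries. *)
Definition linfnorm k (x : 'cV[R]_k) : R := `|x|.

Definition l2ball k : set 'cV[R]_k := [set x : 'cV[R]_k | l2norm x <= 1].
Definition simplex k : set 'cV[R]_k :=
  [set y : 'cV[R]_k | (forall i, 0 <= y i 0) /\ l1norm y = 1].

Context {n m : nat}.
Implicit Types z w u gamma : zspace R n m.

Definition domain : set (zspace R n m) := @l2ball n `*` @simplex m.

Definition pairing gamma z : R := dot gamma.1 z.1 + dot gamma.2 z.2.
Definition znorm z : R := Num.sqrt (l2norm z.1 ^+ 2 + l1norm z.2 ^+ 2).
Definition dualnorm gamma : R :=
  Num.sqrt (l2norm gamma.1 ^+ 2 + linfnorm gamma.2 ^+ 2).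

(** [q * log (q / p)], with 0 log 0 = 0 and value +oo if p = 0 < q. *)
Definition kl_term (p q : R) : \bar R :=
  if q == 0 then 0%E else if p == 0 then +oo%E else (q * ln (q / p))%:E.

(** [bregman z z'] is V_z(z'), with reference point [z]. *)
Definition bregman z z' : \bar R :=
  ((2^-1 * l2norm (z.1 - z'.1) ^+ 2)%:E
   + \sum_(i < m) kl_term (z.2 i 0%R) (z'.2 i 0%R))%E.

Definition monotone_op (g : zspace R n m -> zspace R n m) : Prop :=
  forall z z', domain z -> domain z' -> 0 <= pairing (g z' - g z) (z' - z).

Definition lipschitz_op (L : R) (g : zspace R n m -> zspace R n m) : Prop :=
  forall z z', domain z -> domain z' ->
    dualnorm (g z - g z') <= L * znorm (z - z').

(** The minimizer over [domain] of an extended-real valued function (0 if there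
    is none). *)
Definition argmin (f : zspace R n m -> \bar R) : zspace R n m :=
  xget 0 [set w : zspace R n m | domain w /\ forall u, domain u -> (f w <= f u)%E].

Definition prox_step (alpha eta : R) (w0 w gamma : zspace R n m) :
    zspace R n m :=
  argmin (fun u => ((pairing gamma u)%:E + (alpha / 2)%:E * bregman w0 u
                    + (eta^-1)%:E * bregman w u)%E).

End geometry.

Section estimator.
Context {R : realType} {n m : nat} {d : measure_display}.
Context {S : measurableType d} (mu : probability S R).

Definition expected_cV k (X : S -> 'cV[R]_k) : 'cV[R]_k :=
  \col_i fine 'E_mu[fun s => X s i 0].

(** A stochastic estimator is a function [gt] of the query point and of a random
    seed with law [mu], jointly measurable on [domain]. *)
Definition stochastic_estimator (gt : zspace R n m -> S -> zspace R n m) : Prop :=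
  measurable_fun (domain `*` [set: S])
    (fun p : zspace R n m * S => gt p.1 p.2).

(** The means in the first two clauses are finite by the last two clauses. *)
Definition centered_bounded_biased (w0 : zspace R n m) (L tau : R)
    (g : zspace R n m -> zspace R n m) (gt : zspace R n m -> S -> zspace R n m) :
    Prop :=
  stochastic_estimator gt /\
  forall w, domain w ->
  [/\ expected_cV (fun s => (gt w s).1) = (g w).1,
      linfnorm (expected_cV (fun s => (gt w s).2) - (g w).2)
        <= L ^+ 2 / tau * znorm (w - w0) ^+ 2,
      {ae mu, forall s, linfnorm ((gt w s).2 - (g w0).2) <= tau} &
      ('E_mu[fun s => (l2norm ((gt w s).1 - (g w0).1) ^+ 2)%R]
       + \big[maxe/0]_(i < m)
           'E_mu[fun s => (((gt w s).2 - (g w0).2) i 0 ^+ 2)%R]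
       <= (L ^+ 2 * znorm (w - w0) ^+ 2)%:E)%E].

(** [iterate gt alpha eta w0 s t] is w_t when the t-th estimator call, at
    w_(t-1), uses the seed [s (t-1)]. *)
Fixpoint iterate (gt : zspace R n m -> S -> zspace R n m) (alpha eta : R)
    (w0 : zspace R n m) (s : nat -> S) (t : nat) : zspace R n m :=
  if t is t'.+1 then
    let w := iterate gt alpha eta w0 s t' in
    prox_step alpha eta w0 w (gt w (s t'))
  else w0.

End estimator.

Section randomness.
Context {R : realType} {d' : measure_display}.
Context {Omega : measurableType d'} (P : probability Omega R).

(** The first [T] seeds are mutually independent with common law [mu]. The
    product rule for subfamilies is the case where some [A t] are full. *)
Definition iid_seeds {d : measure_display} {S : measurableType d}
    (mu : probability S R) (T : nat) (xi : nat -> {RV P >-> S}) : Prop :=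
  (forall t, (t < T)%N ->
     forall A : set S, measurable A -> distribution P (xi t) A = mu A) /\
  (forall A : nat -> set S, (forall t, measurable (A t)) ->
     P (\bigcap_(t in `I_T) xi t @^-1` A t)
     = (\prod_(t < T) P (xi t @^-1` A t))%E).

Context {n m : nat}.

(** E [max_(u in domain) F u] <= c: the maximum is attained and finite, and is
    an integrable random variable [M] of mean at most [c]. *)
Definition expected_max_le (F : Omega -> zspace R n m -> \bar R) (c : R) :
    Prop :=
  exists M : Omega -> R,
    [/\ forall omega,
          (exists2 u, domain u & F omega u = (M omega)%:E) /\
          (forall u, domain u -> (F omega u <= (M omega)%:E)%E),
        P.-integrable [set: Omega] (EFin \o M) &
        ('E_P[M] <= c%:E)%E].

(** The random point [z'] is an admissible output, on input [z], of an
    (alpha, eps)-relaxed proximal oracle for [g]. *)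
Definition relaxed_proximal_output (alpha eps : R)
    (g : zspace R n m -> zspace R n m) (z : zspace R n m)
    (z' : Omega -> zspace R n m) : Prop :=
  [/\ measurable_fun [set: Omega] z',
      forall omega, domain (z' omega) &
      expected_max_le (fun omega u =>
        ((pairing (g (z' omega)) (z' omega - u))%:E
         - alpha%:E * bregman z u)%E) eps].

End randomness.

(* Main.v *)
Require Import Defs.
From HB Require Import structures.
From mathcomp Require Import all_boot all_order all_algebra.
From mathcomp Require Import all_classical all_reals all_analysis.
From mathcomp Require Import measurable_realfun.
From mathcomp Require Import ring lra.

Set Implicit Arguments.
Unset Strict Implicit.
Unset Printing Implicit Defensive.

Import Order.TTheory GRing.Theory Num.Theory.
Import numFieldNormedType.Exports.

Local Open Scope classical_set_scope.
Local Open Scope ring_scope.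

(** Write [V] for [bregman w0] and [N_t] for [znorm (w_t - w0) ^+ 2].  The
    three-point inequality of the proximal steps and the local-norm bound
    [e^x <= 1 + x + 3/2 x^2] bound the regret of the iterates against the
    stochastic gradients by
    [V u + (eta alpha / 2) sum_t (V u - V w_t)] plus second-order terms of mean
    [O(eta^2 L^2 N_t)].  Replacing the stochastic gradients by their conditional
    means has to hold uniformly in [u]: the centered noise is fed to a second
    proximal sequence (ghost iterates), which costs another [V u], the same
    second-order terms and a martingale difference.  Since
    [eta alpha T / 2 >= 2], both copies of [V u] are absorbed; Pinsker's
    inequality [N_t <= 2 V w_t] absorbs the bias and the second-order terms in
    [- (eta alpha / 2) sum_t V w_t].  As no estimate is drawn at the last
    iterate, its mean is used there instead. *)

(** Each gradient is split into [g w0] and a difference from it. The part [g w0] is paired with the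
    next iterate and costs nothing at second order, so only differences from [g w0] are squared, and
    these are what the CBB conditions bound by [N_t]. As [eta tau = 1], the scaled differences are
    at most 1 in each coordinate of the second block, and at most 2 after centering; this is why the
    exponential bound is needed on [[-2, 2]]. The second-order terms are weighted by the coordinates
    of a point that is independent of the fresh seed. A weighted mean of [E c_i^2] is at most
    [max_i E c_i^2], so no bound on [E max_i] is required. The constant 24 leaves a small margin: in
    units of [eta^2 L^2 N_t], the two second-order terms cost 3/2 each and the bias 2, in total 5,
    while [eta alpha / 2 = 12 eta^2 L^2] and Pinsker's inequality provide 6. *)

(** * Scalar inequalities for the exponential and the logarithm *)

Section real_inequalities.
Context {R : realType}.
Implicit Types x y : R.

(** The factor [x - a] in the sign condition lets a minimum at [a] be compared with points on both
    of its sides at once. *)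
Lemma is_derive_le (f df : R -> R) (a x : R) :
  (forall z, (a <= z <= x) || (x <= z <= a) -> is_derive z 1 f (df z)) ->
  (forall z, (a <= z <= x) || (x <= z <= a) -> 0 <= df z * (x - a)) ->
  f a <= f x.
Proof.
move=> fdf df_ge0.
have cf z : (a <= z <= x) || (x <= z <= a) -> {for z, continuous f}.
  by move=> /fdf h; apply: differentiable_continuous; apply/derivable1_diffP.
have [ax|xa|->//] := ltgtP a x.
- have [z||z zin e] := @MVT R f df a x ax.
  + by rewrite in_itv => /andP[za zx]; apply: fdf; rewrite (ltW za) (ltW zx).
  + apply: continuous_in_subspaceT => z; rewrite inE/= in_itv/= => h.
    by apply: cf; rewrite h.
  + rewrite -subr_ge0 e; apply: df_ge0.
    by move: zin; rewrite in_itv => /andP[za zx]; rewrite (ltW za) (ltW zx).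
- have [z||z zin e] := @MVT R f df x a xa.
  + by rewrite in_itv => /andP[za zx]; apply: fdf; rewrite (ltW za) (ltW zx) orbT.
  + apply: continuous_in_subspaceT => z; rewrite inE/= in_itv/= => h.
    by apply: cf; rewrite h orbT.
  + rewrite -subr_ge0 -opprB e -mulrN opprB; apply: df_ge0.
    by move: zin; rewrite in_itv => /andP[za zx]; rewrite (ltW za) (ltW zx) orbT.
Qed.

Lemma expR_le_quadratic1 x : `|x| <= 1 -> expR x <= 1 + x + x ^+ 2.
Proof.
rewrite ler_norml => /andP[x1 x2].
(* Clearing the exponential turns the claim into [f 0 <= f x]; the derivative [z (1 - z) e^(-z)] has
   the sign of [z] on [[-1, 1]]. *)
pose f (y : R) := (1 + y + y ^+ 2) * expR (- y).
have df (z : R) : is_derive z 1 f (z * (1 - z) * expR (- z)).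
  have dp := is_deriveD (is_deriveD (is_derive_cst (1 : R) z 1) (is_derive_id z 1))
    (is_deriveX 2 (is_derive_id z (1 : R))).
  have de := is_derive1_comp (is_derive_expR (- z)) (is_deriveNid z 1).
  have fE : f = (cst 1 + id + id ^+ 2) * (expR \o -%R).
    by apply/funext => y; rewrite /f !fctE.
  rewrite fE; apply: (is_derive_eq (is_deriveM dp de)).
  by rewrite /GRing.scale/= !fctE /=; ring.
have : f 0 <= f x.
  apply: (is_derive_le (fun z _ => df z)) => z zx.
  rewrite subr0 mulrAC mulr_ge0 ?expR_ge0//.
  by move: zx => /orP[]/andP[? ?]; nra.
rewrite /f oppr0 expR0 expr0n !addr0 mulr1 expRN => h.
by move: h; rewrite ler_pdivlMr ?expR_gt0 // mul1r.
Qed.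

(** Squaring the bound at [a = x / 2] doubles the range; with the constant 3/2 the remainder factors
    as [a^2 (1 - a) (3 + a)]. *)
Lemma expR_le_quadratic x : `|x| <= 2 -> expR x <= 1 + x + 3 / 2 * x ^+ 2.
Proof.
move=> x2; have h : `|x / 2| <= 1.
  rewrite normrM [X in _ * X]ger0_norm; last by rewrite invr_ge0.
  by rewrite ler_pdivrMr ?mul1r.
have ea := expR_le_quadratic1 h.
move: h; rewrite ler_norml => /andP[h1 h2].
have -> : expR x = expR (x / 2) * expR (x / 2).
  by rewrite -expRD; congr expR; field.
have e0 := expR_gt0 (x / 2); set e := expR _ in ea e0 *.
have {1 2}-> : x = 2 * (x / 2) by field.
set a := x / 2 in h1 h2 ea *.
apply: (@le_trans _ _ ((1 + a + a ^+ 2) ^+ 2)).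
  by rewrite [X in _ <= X]expr2; apply: ler_pM => //; exact: ltW.
rewrite -subr_ge0 (_ : _ - _ = a ^+ 2 * ((1 - a) * (3 + a))); last by field.
by apply: mulr_ge0; [exact: sqr_ge0|apply: mulr_ge0; lra].
Qed.

(** Both sides agree to third order at 1. At [x = q / p], multiplied by [p], this bounds one entropy
    term below by a quadratic with denominator [q + 2 p]. *)
Lemma ln_ge_rational x : 0 < x ->
  3 * (x - 1) ^+ 2 / (2 * (x + 2)) <= x * ln x - x + 1.
Proof.
move=> x0.
(* Up to the constant 5/2, this is the difference of the two sides divided by [x], in partial
   fractions. Its derivative has the sign of [z - 1]. *)
pose f := @ln R + (1 / 4) *: (fun y : R => (id y)^-1)
   + (27 / 4) *: (fun y : R => ((id + cst 2) y)^-1).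
have pos (z : R) : (1 <= z <= x) || (x <= z <= 1) -> 0 < z.
  by move=> /orP[]/andP[? ?]; lra.
have df (z : R) : (1 <= z <= x) || (x <= z <= 1) ->
    is_derive z 1 f ((z - 1) ^+ 3 / (z ^+ 2 * (z + 2) ^+ 2)).
  move=> /pos z0.
  have z2 : z + 2 != 0 by rewrite gt_eqF// addr_gt0.
  have zn0 : z != 0 by rewrite gt_eqF.
  have d1 := @is_deriveV R id z 1 1 zn0 (is_derive_id _ _).
  have d2 := @is_deriveV R (id + cst (2 : R)) z _ (1 : R) z2
    (is_deriveD (is_derive_id z 1) (is_derive_cst (2 : R) z 1)).
  apply: (is_derive_eq (is_deriveD (is_deriveD (is_derive1_ln z0)
    (is_deriveZ (1 / 4) d1)) (is_deriveZ (27 / 4) d2))).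
  by rewrite /GRing.scale/= !fctE; field; rewrite z2 zn0.
have : f 1 <= f x.
  apply: (is_derive_le df) => z zx; have z0 := pos z zx.
  rewrite mulrAC divr_ge0//; last by rewrite mulr_ge0 ?sqr_ge0.
  rewrite exprS -mulrA mulrCA mulr_ge0 ?sqr_ge0//.
  by move: zx => /orP[]/andP[? ?]; nra.
rewrite /f !fctE ln1 add0r => h.
rewrite -subr_ge0.
have -> : x * ln x - x + 1 - 3 * (x - 1) ^+ 2 / (2 * (x + 2)) =
  x * (ln x + 1 / 4 * x^-1 + 27 / 4 * (x + 2)^-1 - (1 / 4 * 1^-1 + 27 / 4 * (1
    + 2)^-1)).
  by field; lra.
by rewrite mulr_ge0 ?subr_ge0// ltW.
Qed.
End real_inequalities.

(** * Divergences, Pinsker's inequality and the closed form of the proximal step *)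

Section geometry.
Context {R : realType}.

Lemma l2norm_sqr k (x : 'cV[R]_k) : l2norm x ^+ 2 = \sum_i x i 0 ^+ 2.
Proof. by rewrite sqr_sqrtr// sumr_ge0// => i _; rewrite sqr_ge0. Qed.

Lemma l2norm_ge0 k (x : 'cV[R]_k) : 0 <= l2norm x.
Proof. exact: sqrtr_ge0. Qed.

Lemma l2ballP k (x : 'cV[R]_k) : l2ball x <-> \sum_i x i 0 ^+ 2 <= 1.
Proof.
rewrite -l2norm_sqr /l2ball/=; split=> h; first by rewrite expr_le1 ?l2norm_ge0.
by rewrite expr_le1 ?l2norm_ge0 in h.
Qed.

Lemma simplexP k (y : 'cV[R]_k) :
  simplex y <-> (forall i, 0 <= y i 0) /\ \sum_i y i 0 = 1.
Proof.
split=> -[y0 y1]; split=> //; rewrite -y1 /l1norm; apply: eq_bigr => i _;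
  by rewrite ger0_norm.
Qed.

Lemma l1norm_ge0 k (x : 'cV[R]_k) : 0 <= l1norm x.
Proof. exact: sumr_ge0. Qed.

Lemma linfnorm_coord k (x : 'cV[R]_k) i : `|x i 0| <= linfnorm x.
Proof.
rewrite /linfnorm /Num.norm/= mx_normrE.
exact: (le_bigmax _ (fun ij : 'I_k * 'I_1 => `|x ij.1 ij.2|) (i, 0)).
Qed.

Lemma dot_holder k (x y : 'cV[R]_k) : dot x y <= linfnorm x * l1norm y.
Proof.
rewrite mulr_sumr; apply: ler_sum => i _.
rewrite (le_trans (ler_norm _))// normrM ler_wpM2r//.
exact: linfnorm_coord.
Qed.

Lemma simplex_l1diam k (y u : 'cV[R]_k) :
  simplex y -> simplex u -> l1norm (y - u) <= 2.
Proof.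
move=> [_ y1] [_ u1]; rewrite -(_ : l1norm y + l1norm u = 2); last first.
  by rewrite y1 u1.
rewrite /l1norm -big_split/=; apply: ler_sum => i _; rewrite !mxE.
exact: ler_normB.
Qed.

Context {n m : nat}.
Implicit Types z w u gamma : zspace R n m.

Lemma pairingDl gamma gamma' z :
  pairing (gamma + gamma') z = pairing gamma z + pairing gamma' z.
Proof.
by rewrite /pairing /dot addrACA -!big_split/=; congr (_ + _);
  apply: eq_bigr => i _; rewrite !mxE mulrDl.
Qed.

Lemma pairingDr gamma z z' :
  pairing gamma (z + z') = pairing gamma z + pairing gamma z'.
Proof.
by rewrite /pairing /dot addrACA -!big_split/=; congr (_ + _);
  apply: eq_bigr => i _; rewrite !mxE mulrDr.
Qed.

Lemma pairingZl c gamma z : pairing (c *: gamma) z = c * pairing gamma z.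
Proof.
by rewrite /pairing /dot mulrDr !mulr_sumr; congr (_ + _);
  apply: eq_bigr => i _; rewrite !mxE mulrA.
Qed.

Lemma pairingZr c gamma z : pairing gamma (c *: z) = c * pairing gamma z.
Proof.
by rewrite /pairing /dot mulrDr !mulr_sumr; congr (_ + _);
  apply: eq_bigr => i _; rewrite !mxE mulrCA.
Qed.

Lemma pairingNr gamma z : pairing gamma (- z) = - pairing gamma z.
Proof. by rewrite -scaleN1r pairingZr mulN1r. Qed.

Lemma pairingNl gamma z : pairing (- gamma) z = - pairing gamma z.
Proof. by rewrite -scaleN1r pairingZl mulN1r. Qed.

Lemma pairingBr gamma z z' :
  pairing gamma (z - z') = pairing gamma z - pairing gamma z'.
Proof. by rewrite pairingDr pairingNr. Qed.

Lemma pairing_suml (I : Type) (r : seq I) (F : I -> zspace R n m) z :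
  pairing (\sum_(i <- r) F i) z = \sum_(i <- r) pairing (F i) z.
Proof.
elim: r => [|i r IH]; last by rewrite !big_cons pairingDl IH.
by rewrite !big_nil -(scale0r (0 : zspace R n m)) pairingZl mul0r.
Qed.

(** Real-valued version of [bregman]; the two agree under [dominated], outside of which [bregman] is
    infinite. *)
Definition rbregman w u : R :=
  2^-1 * l2norm (w.1 - u.1) ^+ 2 + \sum_i u.2 i 0 * ln (u.2 i 0 / w.2 i 0).

Definition dominated w u := forall i, w.2 i 0 = 0 -> u.2 i 0 = 0.

Lemma bregman_dominated w u : dominated w u ->
  bregman w u = (rbregman w u)%:E.
Proof.
move=> wu; rewrite /bregman /rbregman EFinD -sumEFin; congr (_ + _)%E.
apply: eq_bigr => i _; rewrite /kl_term.
case: eqP => [->|u0]; first by rewrite mul0r.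
by case: eqP => // /wu.
Qed.

Lemma bregman_pinfty w u : ~ dominated w u -> bregman w u = +oo%E.
Proof.
move=> /existsNP[i /not_implyP[wi ui]].
rewrite /bregman (bigD1 i)//= {1}/kl_term wi eqxx; case: eqP => // _.
suff h : (\sum_(j < m | j != i) kl_term (w.2 j 0%R) (u.2 j 0%R) != -oo)%E by rewrite
  addye ?addey.
elim/big_ind: _ => [|x y|j _]; [by []|by case: x => [?||]; case: y => [?||]|].
by rewrite /kl_term; case: (u.2 j 0 == 0); case: (w.2 j 0 == 0).
Qed.

Lemma rbregman_refl w : rbregman w w = 0.
Proof.
rewrite /rbregman subrr l2norm_sqr !big1 ?mulr0 ?addr0// => i _.
  have [->|w0] := eqVneq (w.2 i 0) 0; first by rewrite mul0r.
  by rewrite divff// ln1 mulr0.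
by rewrite mxE expr0n.
Qed.

(** In the second block, the conjugate of the entropy divergence over unnormalized vectors:
    [p (e^(-c) - 1 + c)] is the supremum over [q >= 0] of [c (p - q) - q ln (q / p) - (p - q)],
    reached at [q = p e^(-c)]. The weights [w.2] make it a local-norm term. *)
Definition second_order_gap w gamma : R :=
  2^-1 * l2norm gamma.1 ^+ 2
  + \sum_i w.2 i 0 * (expR (- gamma.2 i 0) - 1 + gamma.2 i 0).

(** After cancellation this is [ln r <= r - 1] at [r = p e^(-c) / q], multiplied by [q]. *)
Lemma entropy_fenchel (p q c : R) : 0 <= p -> 0 <= q -> (p = 0 -> q = 0) ->
  c * (p - q) <= q * ln (q / p) + p * (expR (- c) - 1 + c) + (p - q).
Proof.
move=> p0 q0 pq.
suff : q * (1 - c - ln (q / p)) <= p * expR (- c) by lra.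
have [->|qn0] := eqVneq q 0; first by rewrite mul0r mulr_ge0 ?expR_ge0.
have {}q0 : 0 < q by rewrite lt_neqAle eq_sym qn0.
have {}p0 : 0 < p.
  by rewrite lt_neqAle p0 andbT; apply/eqP => e; rewrite pq// eqxx in qn0.
have r0 : 0 < p * expR (- c) / q by rewrite divr_gt0// mulr_gt0// expR_gt0.
have := @le_ln1Dx R (p * expR (- c) / q - 1).
rewrite addrCA subrr addr0 ltrBrDl subrr => /(_ r0).
rewrite !ln_div ?posrE ?mulr_gt0 ?expR_gt0// lnM ?posrE ?expR_gt0// expRK.
by rewrite lerBrDr ler_pdivlMr// => h; lra.
Qed.

Lemma pairing_le_gap w u gamma : domain w -> domain u -> dominated w u ->
  pairing gamma (w - u) <= rbregman w u + second_order_gap w gamma.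
Proof.
move=> [_ /simplexP[w0 w1]] [_ /simplexP[u0 u1]] wu.
rewrite /pairing /rbregman /second_order_gap addrACA; apply: lerD.
  rewrite !l2norm_sqr !mulr_sumr -big_split; apply: ler_sum => i _ /=.
  by rewrite !mxE; have := sqr_ge0 (gamma.1 i 0 - (w.1 i 0 - u.1 i 0)); nra.
(* Both vectors have mass 1, so the linear terms [p - q] left by the unnormalized conjugate sum to
   0. *)
have e : \sum_i (w.2 i 0 - u.2 i 0) = 0 by rewrite sumrB w1 u1 subrr.
rewrite -[leRHS]addr0 -[X in _ <= _ + X]e -!big_split/=.
by apply: ler_sum => i _; rewrite !mxE; apply: entropy_fenchel => //; exact: wu.
Qed.

(** The tangent parameter [c] replaces the Cauchy-Schwarz inequality in [pinsker]:
    after summation it is a third of the l1 distance. *)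
Lemma entropy_pinsker (p q c : R) : 0 <= p -> 0 <= q -> (p = 0 -> q = 0) ->
  3 / 2 * (2 * c * `|p - q| - c ^+ 2 * (q + 2 * p)) <= q * ln (q / p) + (p - q).
Proof.
move=> p0 q0 pq.
have [pe|pn0] := eqVneq p 0.
  by rewrite pe (pq pe) subrr normr0 mul0r; lra.
have {}p0 : 0 < p by rewrite lt_neqAle eq_sym pn0.
have s0 : 0 < q + 2 * p by lra.
apply: (@le_trans _ _ (3 / 2 * ((p - q) ^+ 2 / (q + 2 * p)))).
  rewrite ler_pM2l//.
  rewrite ler_pdivlMr// -[(p - q) ^+ 2]real_normK ?num_real//.
  by have := sqr_ge0 (c * (q + 2 * p) - `|p - q|); nra.
have [->|qn0] := eqVneq q 0.
  rewrite subr0 add0r mul0r add0r.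
  by rewrite (_ : _ * _ = 3 / 4 * p); [lra|field].
have {}q0 : 0 < q by rewrite lt_neqAle eq_sym qn0.
have /ln_ge_rational h : 0 < q / p by rewrite divr_gt0.
have := ler_wpM2l (ltW p0) h.
have -> : p * (q / p * ln (q / p) - q / p + 1) = q * ln (q / p) + (p - q) by field.
apply: le_trans; rewrite le_eqVlt; apply/orP; left; apply/eqP; field.
by rewrite pn0 !gt_eqF//; lra.
Qed.

Lemma pinsker w u : domain w -> domain u -> dominated w u ->
  znorm (w - u) ^+ 2 <= 2 * rbregman w u.
Proof.
move=> [_ /simplexP[w0 w1]] [_ /simplexP[u0 u1]] wu.
rewrite sqr_sqrtr ?addr_ge0 ?sqr_ge0// mulrDr mulrA divff// mul1r lerD2l /=.
(* The weights [q + 2 p] sum to 3, so [c = D / 3] maximizes [2 c D - 3 c^2], and the lower bound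
   becomes [D^2 / 2]. *)
set D := l1norm _; pose c := D / 3.
have : 3 / 2 * (2 * c * D - c ^+ 2 * 3) <= \sum_i u.2 i 0 * ln (u.2 i 0 / w.2 i 0).
  have e : \sum_i (w.2 i 0 - u.2 i 0) = 0 by rewrite sumrB w1 u1 subrr.
  have e3 : \sum_i (u.2 i 0 + 2 * w.2 i 0) = 3.
    by rewrite big_split/= -mulr_sumr w1 u1; lra.
  rewrite -[leRHS]addr0 -[X in _ <= _ + X]e -[X in c ^+ 2 * X]e3 /D /l1norm !mulr_sumr
    -sumrB mulr_sumr -big_split/=.
  apply: ler_sum => i _; rewrite !mxE; apply: entropy_pinsker => //; exact: wu.
by rewrite /c => h; have := sqr_ge0 D; nra.
Qed.

Lemma rbregman_ge0 w u : domain w -> domain u -> dominated w u ->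
  0 <= rbregman w u.
Proof.
move=> dw du wu; rewrite -(@pmulr_rge0 _ 2)//.
by apply: le_trans (pinsker dw du wu); exact: sqr_ge0.
Qed.

(** Proximal steps keep exactly the zeros of [w0], so a [u] at finite divergence from [w0] is at
    finite divergence from every iterate. *)
Definition same_support w u := forall i, (w.2 i 0 == 0) = (u.2 i 0 == 0).

Lemma same_support_dominated w0 w u :
  same_support w0 w -> dominated w0 u -> dominated w u.
Proof. by move=> s d i /eqP; rewrite -s => /eqP /d. Qed.

(** Stationarity in the second block, up to the multiplier of the constraint that the entries sum to
    1. *)
Definition prox_log (a b : R) w0 w gamma (i : 'I_m) : R :=
  (a * ln (w0.2 i 0) + b * ln (w.2 i 0) - gamma.2 i 0) / (a + b).

(** The minimizer over [domain] of
    [<gamma, u> + a V_w0(u) + b V_w(u)], for [w0] and [w] with the same support. *)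
Definition prox (a b : R) w0 w gamma : zspace R n m :=
  let p := (a + b)^-1 *: (a *: w0.1 + b *: w.1 - gamma.1) in
  let th := prox_log a b w0 w gamma in
  ((Num.max 1 (l2norm p))^-1 *: p,
   \col_i if w0.2 i 0 == 0 then 0
           else expR (th i - ln (\sum_(j | w0.2 j 0 != 0) expR (th j)))).

(** [x - c x] is a nonpositive multiple of [x], and [dot x (x - u) >= (|x|^2 - |u|^2) / 2 >= 0]. *)
Lemma sphere_normal_cone k (x u : 'cV[R]_k) (c : R) :
  \sum_i x i 0 ^+ 2 = 1 -> \sum_i u i 0 ^+ 2 <= 1 -> 1 <= c ->
  dot (x - c *: x) (x - u) <= 0.
Proof.
move=> x1 u1 c1.
apply: (@le_trans _ _
  ((1 - c) * (\sum_i x i 0 ^+ 2 - (\sum_i x i 0 ^+ 2 + \sum_i u i 0 ^+ 2) / 2))).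
  rewrite -big_split/= mulr_suml -sumrB mulr_sumr; apply: ler_sum => i _.
  rewrite !mxE; have c0 : 0 <= c - 1 by lra.
  by have := mulr_ge0 c0 (sqr_ge0 (x i 0 - u i 0)); lra.
by rewrite x1 mulr_le0_ge0 ?subr_le0//; lra.
Qed.

(** [x] is the Euclidean projection of [p] onto the unit ball; the inequality is its variational
    characterization. *)
Lemma prox_x_optimal k (p u : 'cV[R]_k) : l2ball u ->
  let x := (Num.max 1 (l2norm p))^-1 *: p in
  l2ball x /\ dot (x - p) (x - u) <= 0.
Proof.
move=> /l2ballP u1 /=.
have [p1|p1] := leP (l2norm p) 1.
  rewrite invr1 scale1r; split=> //.
  by rewrite /dot big1// => i _; rewrite !mxE subrr mul0r.
set c := l2norm p in p1 *; have c0 : 0 < c by lra.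
have x1 : \sum_i (c^-1 *: p) i 0 ^+ 2 = 1.
  under eq_bigr do rewrite mxE exprMn.
  by rewrite -mulr_sumr -l2norm_sqr -/c -exprMn mulVf ?expr1n// gt_eqF.
split; first by apply/l2ballP; rewrite x1.
set x := _ *: _ in x1 *.
have -> : p = c *: x by rewrite scalerA divff ?scale1r// gt_eqF.
exact: (sphere_normal_cone x1 u1 (ltW p1)).
Qed.

Lemma prox_domain (a b : R) w0 w gamma : domain w0 ->
  domain (prox a b w0 w gamma) /\ same_support w0 (prox a b w0 w gamma).
Proof.
move=> [w0x /simplexP[w0y w0y1]].
(* The entries of [w0.2] sum to 1, so its support is nonempty and the normalizing sum is
   positive. *)
have Z0 : 0 < \sum_(j | w0.2 j 0 != 0) expR (prox_log a b w0 w gamma j).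
  have [[j wj]|/forallNP z] := pselect (exists j, w0.2 j 0 != 0).
    rewrite (bigD1 j)//= ltr_wpDr ?expR_gt0//.
    by rewrite sumr_ge0// => i _; exact: expR_ge0.
  move: w0y1; rewrite big1 => [/eqP|i _]; first by rewrite eq_sym oner_eq0.
  by have /negP := z i; rewrite negbK => /eqP.
split.
- split; first by have [] := prox_x_optimal ((a + b)^-1 *: (a *: w0.1 + b *: w.1
  - gamma.1)) w0x.
  apply/simplexP; split=> [i|]; first by rewrite mxE; case: ifP => // _;
    exact: expR_ge0.
  under eq_bigr do rewrite mxE.
  rewrite (bigID (fun i => w0.2 i 0 == 0))/= big1 ?add0r; last by move=> i ->.
  under eq_bigr => i /negbTE wi do rewrite wi expRD expRN lnK ?posrE//.
  by rewrite -mulr_suml divff// gt_eqF.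
- by move=> i /=; rewrite mxE; case: (w0.2 i 0 == 0); rewrite ?eqxx ?expR_eq0.
Qed.

(** Three-point inequality with two reference points. All slack comes from the ball constraint; in
    the second block optimality is an identity, because the minimizer charges the whole support of
    [w0]. *)
Lemma prox_optimal (a b : R) w0 w gamma u : 0 <= a -> 0 <= b -> 0 < a + b ->
  domain w0 -> domain w -> same_support w0 w ->
  domain u -> dominated w0 u ->
  let w' := prox a b w0 w gamma in
  pairing gamma (w' - u)
  + a * (rbregman w0 w' + rbregman w' u - rbregman w0 u)
  + b * (rbregman w w' + rbregman w' u - rbregman w u) <= 0.
Proof.
move=> a0 b0 ab0 dw0 dw sw du wu; set w' := prox _ _ _ _ _; rewrite /=.
have [dw' sw'] : domain w' /\ same_support w0 w' := prox_domain _ _ _ _ dw0.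
pose p := (a + b)^-1 *: (a *: w0.1 + b *: w.1 - gamma.1).
have [_ hx] : l2ball w'.1 /\ dot (w'.1 - p) (w'.1 - u.1) <= 0 := prox_x_optimal p du.1.
pose Z := \sum_(j | w0.2 j 0 != 0) expR (prox_log a b w0 w gamma j).
have lw' i : w0.2 i 0 != 0 -> ln (w'.2 i 0) = prox_log a b w0 w gamma i - ln Z.
  by move=> wi; rewrite mxE (negbTE wi) expRK.
clearbody w' Z.
(* Expanding the squares leaves the gradient of the objective at [w'.1], which is
   [(a + b) (w'.1 - p)]. *)
have hx' : dot gamma.1 (w'.1 - u.1)
    + a * (2^-1 * l2norm (w0.1 - w'.1) ^+ 2 + 2^-1 * l2norm (w'.1 - u.1) ^+ 2
      - 2^-1 * l2norm (w0.1 - u.1) ^+ 2)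
    + b * (2^-1 * l2norm (w.1 - w'.1) ^+ 2 + 2^-1 * l2norm (w'.1 - u.1) ^+ 2
      - 2^-1 * l2norm (w.1 - u.1) ^+ 2)
    = (a + b) * dot (w'.1 - p) (w'.1 - u.1).
  rewrite !l2norm_sqr /dot !mulr_sumr -!sumrN -!big_split/= !mulr_sumr -!big_split/=.
  apply: eq_bigr => i _; rewrite !mxE; field; lra.
(* The log-normalization is common to all coordinates, so the residual is a multiple of the
   difference of total masses, which is 0. *)
have hy : dot gamma.2 (w'.2 - u.2)
    + a * (\sum_i w'.2 i 0 * ln (w'.2 i 0 / w0.2 i 0)
      + \sum_i u.2 i 0 * ln (u.2 i 0 / w'.2 i 0)
      - \sum_i u.2 i 0 * ln (u.2 i 0 / w0.2 i 0))
    + b * (\sum_i w'.2 i 0 * ln (w'.2 i 0 / w.2 i 0)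
      + \sum_i u.2 i 0 * ln (u.2 i 0 / w'.2 i 0)
      - \sum_i u.2 i 0 * ln (u.2 i 0 / w.2 i 0))
    = - ((a + b) * ln Z) * \sum_i (w'.2 i 0 - u.2 i 0).
  rewrite /dot !mulr_sumr -!sumrN -!big_split/= !mulr_sumr -!big_split/=.
  apply: eq_bigr => i _.
  have wp (z : zspace R n m) : domain z -> z.2 i 0 != 0 -> 0 < z.2 i 0.
    by move=> [_ /simplexP[z0 _]] zn0; rewrite lt_neqAle eq_sym zn0 z0.
  have [wi|wi] := eqVneq (w0.2 i 0) 0.
    have ui := wu i wi; have /esym := sw' i; have /esym := sw i.
    rewrite wi eqxx => /eqP wi' /eqP w'i.
    by rewrite !mxE w'i ui wi'; ring.
  have w0p := wp _ dw0 wi.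
  have wwp : 0 < w.2 i 0 by apply: wp => //; rewrite -sw.
  have w'p : 0 < w'.2 i 0 by apply: wp => //; rewrite -sw'.
  have lu (z : zspace R n m) : 0 < z.2 i 0 -> u.2 i 0 * ln (u.2 i 0 / z.2 i 0)
      = u.2 i 0 * (ln (u.2 i 0) - ln (z.2 i 0)).
    have [->|ui] := eqVneq (u.2 i 0) 0; first by rewrite !mul0r.
    by move=> z0; rewrite ln_div// posrE wp.
  rewrite !lu// !ln_div ?posrE// lw'// /prox_log !mxE.
  field; lra.
have [_ /simplexP[_ w'1]] := dw'; have [_ /simplexP[_ u1]] := du.
rewrite sumrB w'1 u1 subrr mulr0 in hy.
have : (a + b) * dot (w'.1 - p) (w'.1 - u.1) <= 0 by rewrite pmulr_rle0.
rewrite -hx' /pairing /rbregman => ?; lra.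
Qed.

(** [argmin] is a choice among minimizers, so uniqueness is part of the claim: [prox_optimal] leaves
    the margin [(alpha / 2 + eta^-1) V_w'(u)], and by Pinsker's inequality a zero margin forces
    [u = w']. *)
Lemma prox_stepE (alpha eta : R) w0 w gamma : 0 <= alpha -> 0 < eta ->
  domain w0 -> domain w -> same_support w0 w ->
  prox_step alpha eta w0 w gamma = prox (alpha / 2) eta^-1 w0 w gamma.
Proof.
move=> al0 eta0 dw0 dw sw; rewrite /prox_step /argmin.
pose f u := ((pairing gamma u)%:E + (alpha / 2)%:E * bregman w0 u
             + (eta^-1)%:E * bregman w u)%E.
set w' := prox _ _ _ _ _.
have [dw' sw'] : domain w' /\ same_support w0 w' := prox_domain _ _ _ _ dw0.
have w0w' : dominated w0 w' by move=> i /eqP; rewrite sw' => /eqP.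
pose fr u := pairing gamma u + alpha / 2 * rbregman w0 u + eta^-1 * rbregman w u.
have e0 : 0 < eta^-1 by rewrite invr_gt0.
have fE u : dominated w0 u -> f u = (fr u)%:E.
  move=> du; rewrite /f !bregman_dominated//; exact: same_support_dominated du.
(* Infinity comes from the last term: [w] has the zeros of [w0] and [eta^-1 > 0], whereas the middle
   term is [0 * +oo = 0] when [alpha = 0]. *)
have fy u : ~ dominated w0 u -> f u = +oo%E.
  move=> du; rewrite /f (@bregman_pinfty w); last first.
    by move=> wu; apply: du => i /eqP; rewrite sw => /eqP; exact: wu.
  rewrite gt0_muley ?lte_fin// addey//.
  have [->|aln0] := eqVneq alpha 0; first by rewrite mul0r mul0e.
  by rewrite bregman_pinfty// gt0_muley ?lte_fin// lt_neqAle eq_sym mulf_neq0//=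
    divr_ge0.
have key u : domain u -> dominated w0 u ->
    fr w' + (alpha / 2 + eta^-1) * rbregman w' u <= fr u.
  move=> du wu; have := @prox_optimal (alpha / 2) eta^-1 w0 w gamma u.
  rewrite /fr pairingBr -/w' => h; have := h _ _ _ dw0 dw sw du wu.
  have a2 : 0 <= alpha / 2 by rewrite divr_ge0.
  by move=> /(_ a2 (ltW e0) (ltr_wpDl a2 e0)); lra.
have dom u : dominated w0 u -> dominated w' u := same_support_dominated sw'.
apply: xget_unique; first split=> // u du.
  change (f w' <= f u)%E.
  have [wu|wu] := pselect (dominated w0 u); last by rewrite (fy _ wu) leey.
  rewrite !fE// lee_fin; apply: le_trans (key _ du wu).
  by rewrite lerDl mulr_ge0 ?rbregman_ge0//; [rewrite addr_ge0 ?divr_ge0// ltW|exact: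
    dom].
move=> u [du fuw]; have : (f u <= f w')%E := fuw w' dw'.
rewrite (fE _ w0w').
have [wu|wu] := pselect (dominated w0 u); last by rewrite (fy _ wu).
rewrite fE// lee_fin => h; have := key _ du wu.
have c0 : 0 < alpha / 2 + eta^-1 by rewrite ltr_wpDl ?divr_ge0.
have := pinsker dw' du (dom _ wu).
have : 0 <= rbregman w' u by rewrite rbregman_ge0//; exact: dom.
move=> v0 pk k.
have : (alpha / 2 + eta^-1) * rbregman w' u <= 0 by lra.
rewrite pmulr_rle0// => v1; have v2 : znorm (w' - u) ^+ 2 <= 0 by lra.
move: v2; rewrite sqr_sqrtr ?addr_ge0 ?sqr_ge0// l2norm_sqr => v2.
have : l1norm (w' - u).2 ^+ 2 <= 0.
  by apply: le_trans v2; rewrite lerDr sumr_ge0// => i _; exact: sqr_ge0.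
have : \sum_i (w' - u).1 i 0 ^+ 2 <= 0 by apply: le_trans v2; rewrite lerDl sqr_ge0.
move=> hx; rewrite real_exprn_even_le0 ?num_real//= => /eqP hy.
have {hx} : \sum_i (w' - u).1 i 0 ^+ 2 = 0.
  by apply/eqP; rewrite eq_le hx sumr_ge0// => i _; exact: sqr_ge0.
move=> /psumr_eq0P hx; move/psumr_eq0P: hy => hy.
rewrite (surjective_pairing u) (surjective_pairing w'); congr (_, _);
  apply/matrixP => i j; rewrite (ord1 j).
  have /eqP := hx (fun i _ => sqr_ge0 _) i isT.
  by rewrite expf_eq0/= !mxE subr_eq0 => /eqP.
have /eqP := hy (fun i _ => normr_ge0 _) i isT.
by rewrite normr_eq0 !mxE subr_eq0 => /eqP.
Qed.
End geometry.

(** * Pathwise regret of the iterates and the ghost iterates *)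

Section regret.
Context {R : realType} {n m : nat}.
Variables (alpha eta : R) (w0 : zspace R n m).
Hypotheses (alpha_ge0 : 0 <= alpha) (eta_gt0 : 0 < eta) (dw0 : domain w0).

(** The weights 0 and 1 make this a plain mirror step from [s]; [w0] enters only through its
    support. *)
Lemma ghost_step (s zeta u : zspace R n m) : domain s -> same_support w0 s ->
  domain u -> dominated w0 u ->
  pairing zeta (s - u) + rbregman (prox 0 1 w0 s zeta) u
    <= rbregman s u + second_order_gap s zeta.
Proof.
move=> ds ss du wu; set s' := prox _ _ _ _ _.
have [ds' ss'] : domain s' /\ same_support w0 s' := prox_domain _ _ _ _ dw0.
have a1 : 0 < (0 : R) + 1 by rewrite add0r.
have := prox_optimal zeta (lexx _) ler01 a1 dw0 ds ss du wu.
rewrite /= -/s' mul0r addr0 mul1r.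
have ss1 : dominated s s' by move=> i /eqP; rewrite -ss ss' => /eqP.
have := pairing_le_gap zeta ds ds' ss1.
by rewrite !pairingBr; lra.
Qed.

(** Pairing [g0] with the new point [w'] keeps it out of the second-order term, which involves
    [gh - g0] alone. *)
Lemma mirror_step (w g0 gh u : zspace R n m) : domain w -> same_support w0 w ->
  domain u -> dominated w0 u ->
  let w' := prox (alpha / 2) eta^-1 w0 w gh in
  let gam := eta *: (gh - g0) in
  pairing gam (w - u) + eta * pairing g0 (w' - u)
  + eta * alpha / 2 * (rbregman w0 w' - rbregman w0 u) + rbregman w' u
    <= rbregman w u + second_order_gap w gam.
Proof.
move=> ds ss du wu; rewrite /=; set w' := prox _ _ _ _ _; set gam := eta *: _.
have [dw' sw'] : domain w' /\ same_support w0 w' := prox_domain _ _ _ _ dw0.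
have e0 : 0 < eta^-1 by rewrite invr_gt0.
have a0 : 0 <= alpha / 2 by rewrite divr_ge0.
have := prox_optimal gh a0 (ltW e0) (ltr_wpDl a0 e0) dw0 ds ss du wu.
rewrite /= -/w' -(pmulr_rle0 _ eta_gt0) => h.
have ss1 : dominated w w' by move=> i /eqP; rewrite -ss sw' => /eqP.
have := pairing_le_gap gam ds dw' ss1.
(* The pull towards [w0] also yields [eta alpha / 2] times the divergence from [w'] to [u]; it is
   nonnegative and dropped. *)
have v0 : 0 <= eta * (alpha / 2) * rbregman w' u.
  rewrite mulr_ge0 ?mulr_ge0 ?(ltW eta_gt0)// rbregman_ge0//.
  exact: same_support_dominated sw' wu.
have {h} : eta * pairing gh (w' - u) + eta * (alpha / 2) * (rbregman w0 w'
    + rbregman w' u - rbregman w0 u)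
  + (rbregman w w' + rbregman w' u - rbregman w u) <= 0.
  by move: h; rewrite !mulrDr !(mulrA eta) divff ?gt_eqF// !mul1r.
by rewrite /gam !pairingZl !pairingBr !pairingDl !pairingNl; lra.
Qed.

Variables (g : zspace R n m -> zspace R n m) (w s gh gb : nat -> zspace R n m).
Hypotheses (w_0 : w 0%N = w0) (s_0 : s 0%N = w0).
Hypothesis w_S : forall t, w t.+1 = prox (alpha / 2) eta^-1 w0 (w t) (gh t).
Let gam t := eta *: (gh t - g w0).
Let zeta t := eta *: (gb t - gh t).
Hypothesis s_S : forall t, s t.+1 = prox 0 1 w0 (s t) (zeta t).

Lemma mirror_domain t : domain (w t) /\ same_support w0 (w t).
Proof. by case: t => [|t]; [rewrite w_0|rewrite w_S; exact: prox_domain]. Qed.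

Lemma ghost_domain t : domain (s t) /\ same_support w0 (s t).
Proof. by case: t => [|t]; [rewrite s_0|rewrite s_S; exact: prox_domain]. Qed.

(** The potential is the sum of the divergences to [u] from both sequences, initially twice that
    from [w0]. The noise is paired with [w t - u = (w t - s t) + (s t - u)]: the ghost step bounds
    the second part, and the first no longer involves [u]. *)
Lemma regret_potential T u : domain u -> dominated w0 u ->
  \sum_(t < T) eta * pairing (g (w t) - g w0) (w t - u)
  + \sum_(t < T) (eta * pairing (g w0) (w t.+1 - u)
       + eta * alpha / 2 * (rbregman w0 (w t.+1) - rbregman w0 u))
  + rbregman (w T) u + rbregman (s T) u
  <= 2 * rbregman w0 u
    + \sum_(t < T) (second_order_gap (w t) (gam t)
        + second_order_gap (s t) (zeta t) + pairing (zeta t) (w t - s t)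
        + eta * pairing (g (w t) - gb t) (w t - u)).
Proof.
move=> du wu; elim: T => [|T IH].
  by rewrite !big_ord0 w_0 s_0; lra.
rewrite !big_ord_recr/=.
have [dw sw] := mirror_domain T; have [ds ss] := ghost_domain T.
have := mirror_step (g w0) (gh T) dw sw du wu.
have := ghost_step (zeta T) ds ss du wu.
rewrite /= -w_S -s_S -/(gam T) => hs hw.
suff : eta * pairing (g (w T) - g w0) (w T - u) + eta * pairing (g w0) (w T.+1 - u)
  + eta * alpha / 2 * (rbregman w0 (w T.+1) - rbregman w0 u) + rbregman (w T.+1) u
    + rbregman (s T.+1) u <= rbregman (w T) u + rbregman (s T) u +
  (second_order_gap (w T) (gam T)
        + second_order_gap (s T) (zeta T) + pairing (zeta T) (w T - s T)
        + eta * pairing (g (w T) - gb T) (w T - u)) by lra.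
move: hs hw; rewrite /zeta /gam.
set g1 := second_order_gap _ _; set g2 := second_order_gap _ _.
rewrite !pairingZl !pairingBr !pairingDl !pairingNl; lra.
Qed.

Lemma regret T u : domain u -> dominated w0 u ->
  eta * \sum_(1 <= t < T.+1) pairing (g (w t)) (w t - u)
  - eta * alpha * T%:R * rbregman w0 u
  <= (2 - eta * alpha * T%:R / 2) * rbregman w0 u
    + \sum_(t < T) (second_order_gap (w t) (gam t)
        + second_order_gap (s t) (zeta t) + pairing (zeta t) (w t - s t))
    + second_order_gap (w T) (eta *: (gb T - g w0))
    + \sum_(t < T.+1) eta * pairing (g (w t) - gb t) (w t - u)
    - eta * alpha / 2 * \sum_(t < T.+1) rbregman w0 (w t).
Proof.
move=> du wu; have h := regret_potential T du wu.
have [dw sw] := mirror_domain T; have [ds ss] := ghost_domain T.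
(* The leftover divergence from [w T] to [u] pays for the regret term at index [T], for which no
   step is taken. *)
have h2 := pairing_le_gap (eta *: (gb T - g w0)) dw du (same_support_dominated sw wu).
have h3 := rbregman_ge0 ds du (same_support_dominated ss wu).
rewrite big_add1/= big_mkord.
(* The index range moves from [0..T-1] to [1..T]: the gradient difference vanishes at [w 0 = w0]. *)
have hT : \sum_(t < T.+1) eta * pairing (g (w t) - g w0) (w t - u)
   = \sum_(t < T) eta * pairing (g (w t.+1) - g w0) (w t.+1 - u).
  rewrite big_ord_recl/= w_0 subrr -(scale0r (0 : zspace R n m)) pairingZl mul0r mulr0
    add0r.
  by apply: eq_bigr.
have hV : \sum_(t < T.+1) rbregman w0 (w t) = \sum_(t < T) rbregman w0 (w t.+1).
  by rewrite big_ord_recl/= w_0 rbregman_refl add0r; apply: eq_bigr.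
have hm : \sum_(t < T) eta * pairing (g (w t.+1) - g w0) (w t.+1 - u)
   = eta * \sum_(t < T) pairing (g (w t.+1)) (w t.+1 - u)
     - eta * \sum_(t < T) pairing (g w0) (w t.+1 - u).
  rewrite -mulrBr -sumrB -mulr_sumr; congr (_ * _); apply: eq_bigr => t _.
  by rewrite pairingDl pairingNl.
have hd : \sum_(t < T) (eta * pairing (g w0) (w t.+1 - u)
       + eta * alpha / 2 * (rbregman w0 (w t.+1) - rbregman w0 u))
   = eta * \sum_(t < T) pairing (g w0) (w t.+1 - u)
     + eta * alpha / 2 * \sum_(t < T) rbregman w0 (w t.+1)
     - eta * alpha / 2 * T%:R * rbregman w0 u.
  rewrite big_split/= -!mulr_sumr sumrB sumr_const card_ord -mulr_natl.
  by ring.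
have he := big_split +%R (index_enum 'I_T) xpredT
  (fun t : 'I_T => second_order_gap (w t) (gam t) + second_order_gap (s t) (zeta t)
     + pairing (zeta t) (w t - s t))
  (fun t : 'I_T => eta * pairing (g (w t) - gb t) (w t - u)).
move: h2; rewrite pairingZl => h2.
have hl : pairing (g (w T) - g w0) (w T - u) =
  pairing (gb T - g w0) (w T - u) + pairing (g (w T) - gb T) (w T - u).
  by rewrite -pairingDl; congr (pairing _ _); rewrite [RHS]addrC subrKA.
move: h hT; rewrite he hd hm hV !big_ord_recr/= hl; lra.
Qed.
End regret.

(** * Measurability of the vector operations and of the proximal map *)

Section measurability.
Context {R : realType}.

Lemma measurable_cV_coord k (i : 'I_k) :
  measurable_fun [set: 'cV[R]_k] (fun x => x i 0).
Proof.
move=> _ Y mY; rewrite setTI; apply: sub_sigma_algebra => /=.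
rewrite -bigcup_seq/=; exists i => /=; first by rewrite mem_index_enum.
by exists Y => //; rewrite setTI.
Qed.

Context d (T : measurableType d).

Lemma measurable_cVP k (f : T -> 'cV[R]_k) :
  measurable_fun setT f <-> forall i, measurable_fun setT (fun t => f t i 0).
Proof.
split=> [mf i|mf]; first exact: (measurableT_comp (measurable_cV_coord i) mf).
move=> _ Y; rewrite setTI => mY.
pose C := [set B : set 'cV[R]_k | measurable (f @^-1` B)].
suff : g_sigma_preimage (@cV_coord R k) `<=` C by apply.
apply: smallest_sub.
  split; first by rewrite /C/= preimage_set0.
  - by move=> B CB; rewrite /C/= setTD preimage_setC; exact: measurableC.
  - move=> F CF; rewrite /C/= preimage_bigcup; by apply: bigcup_measurable => i _;
    exact: CF.
rewrite -bigcup_seq/= => B [i _ [A mA <-]].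
rewrite /C /= setTI -comp_preimage -[X in measurable X]setTI.
exact: mf.
Qed.

Lemma measurable_zP n m (f : T -> zspace R n m) :
  measurable_fun setT f <->
  (forall i, measurable_fun setT (fun t => (f t).1 i 0)) /\
  (forall i, measurable_fun setT (fun t => (f t).2 i 0)).
Proof.
split=> [/measurable_fun_pairP[m1 m2]|[m1 m2]].
  by split=> i; [exact: ((measurable_cVP _).1 m1)|exact: ((measurable_cVP _).1 m2)].
apply/measurable_fun_pairP; split; apply/measurable_cVP; [exact: m1|exact: m2].
Qed.

Lemma measurable_dot k (f h : T -> 'cV[R]_k) :
  measurable_fun setT f -> measurable_fun setT h ->
  measurable_fun setT (fun t => dot (f t) (h t)).
Proof.
move=> /measurable_cVP mf /measurable_cVP mh.
by apply: measurable_sum => i; apply: measurable_funM.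
Qed.

Lemma measurable_invr (f : T -> R) : (forall t, 0 < f t) ->
  measurable_fun setT f -> measurable_fun setT (fun t => (f t)^-1).
Proof.
move=> f0 mf; rewrite (_ : (fun _ => _) = expR \o (fun t => - ln (f t))).
  apply: measurableT_comp => //; apply: measurable_funN.
  exact: measurableT_comp (@measurable_ln R) mf.
by apply/funext => t /=; rewrite expRN lnK// posrE.
Qed.

Lemma measurable_sqrt (f : T -> R) :
  measurable_fun setT f -> measurable_fun setT (fun t => Num.sqrt (f t)).
Proof.
move=> mf; apply: (measurableT_comp _ mf).
by apply: continuous_measurable_fun; exact: sqrt_continuous.
Qed.

Lemma measurable_l2norm k (f : T -> 'cV[R]_k) :
  measurable_fun setT f -> measurable_fun setT (fun t => l2norm (f t)).
Proof.
move=> /measurable_cVP mf; apply: measurable_sqrt; apply: measurable_sum => i.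
exact: measurable_funX.
Qed.

Lemma measurable_cVD k (f h : T -> 'cV[R]_k) : measurable_fun setT f ->
  measurable_fun setT h -> measurable_fun setT (fun t => f t + h t).
Proof.
move=> /measurable_cVP mf /measurable_cVP mh; apply/measurable_cVP => i.
by under eq_fun do rewrite mxE; exact: measurable_funD.
Qed.

Lemma measurable_cVZ k (c : T -> R) (f : T -> 'cV[R]_k) :
  measurable_fun setT c -> measurable_fun setT f ->
  measurable_fun setT (fun t => c t *: f t).
Proof.
move=> mc /measurable_cVP mf; apply/measurable_cVP => i.
by under eq_fun do rewrite mxE; exact: measurable_funM.
Qed.

Context {n m : nat}.
Implicit Types f h : T -> zspace R n m.

Lemma measurable_zD f h : measurable_fun setT f -> measurable_fun setT h ->
  measurable_fun setT (fun t => f t + h t).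
Proof.
move=> /measurable_fun_pairP[f1 f2] /measurable_fun_pairP[h1 h2].
by apply/measurable_fun_pairP; split; exact: measurable_cVD.
Qed.

Lemma measurable_zZ (c : R) f : measurable_fun setT f ->
  measurable_fun setT (fun t => c *: f t).
Proof.
move=> /measurable_fun_pairP[f1 f2].
by apply/measurable_fun_pairP; split; apply: measurable_cVZ.
Qed.

Lemma measurable_zB f h : measurable_fun setT f -> measurable_fun setT h ->
  measurable_fun setT (fun t => f t - h t).
Proof.
move=> mf mh; apply: measurable_zD => //.
by under eq_fun do rewrite -scaleN1r; exact: measurable_zZ.
Qed.

Lemma measurable_z_sum (I : Type) (r : seq I) (F : I -> T -> zspace R n m) :
  (forall i, measurable_fun setT (F i)) ->
  measurable_fun setT (fun t => \sum_(i <- r) F i t).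
Proof.
move=> mF; elim: r => [|i r IH]; first by under eq_fun do rewrite big_nil;
  exact: measurable_cst.
by under eq_fun do rewrite big_cons; exact: measurable_zD.
Qed.

Lemma measurable_pairing f h : measurable_fun setT f -> measurable_fun setT h ->
  measurable_fun setT (fun t => pairing (f t) (h t)).
Proof.
move=> /measurable_fun_pairP[f1 f2] /measurable_fun_pairP[h1 h2].
by apply: measurable_funD; exact: measurable_dot.
Qed.

Lemma measurable_rbregman (w0 : zspace R n m) f : measurable_fun setT f ->
  measurable_fun setT (fun t => rbregman w0 (f t)).
Proof.
move=> mf; have [/measurable_fun_pairP[m1 _] [_ m2]] := (mf, (measurable_zP f).1 mf).
apply: measurable_funD.
  apply: measurable_funM => //; apply: measurable_funX; apply: measurable_l2norm.
  have /measurable_fun_pairP[+ _] := measurable_zB (measurable_cst w0) mf.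
  exact.
apply: measurable_sum => i; apply: measurable_funM => //.
by apply: (measurableT_comp (@measurable_ln R)); exact: measurable_funM.
Qed.

Lemma measurable_second_order_gap f h :
  measurable_fun setT f -> measurable_fun setT h ->
  measurable_fun setT (fun t => second_order_gap (f t) (h t)).
Proof.
move=> /measurable_zP[_ f2] mh.
have [/measurable_fun_pairP[h1 _] [_ h2]] := (mh, (measurable_zP h).1 mh).
apply: measurable_funD.
  by apply: measurable_funM => //; apply: measurable_funX; exact: measurable_l2norm.
apply: measurable_sum => i; apply: measurable_funM => //.
apply: measurable_funD => //; apply: measurable_funB => //.
by apply: measurableT_comp => //; exact: measurable_funN.
Qed.

Lemma measurable_prox (a b : R) (w0 : zspace R n m) f h :
  measurable_fun setT f -> measurable_fun setT h ->
  measurable_fun setT (fun t => prox a b w0 (f t) (h t)).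
Proof.
move=> mf mh.
have [/measurable_fun_pairP[f1 _] [_ f2]] := (mf, (measurable_zP f).1 mf).
have [/measurable_fun_pairP[h1 _] [_ h2]] := (mh, (measurable_zP h).1 mh).
apply/measurable_fun_pairP; split.
  pose p t := (a + b)^-1 *: (a *: w0.1 + b *: (f t).1 - (h t).1).
  have mp : measurable_fun setT p.
    apply: measurable_cVZ => //; apply: measurable_cVD.
      by apply: measurable_cVD => //; apply: measurable_cVZ.
    by rewrite /=; under eq_fun do rewrite -scaleN1r; apply: measurable_cVZ.
  apply: (measurable_cVZ _ mp); apply: measurable_invr.
    by move=> t; rewrite lt_max ltr01.
  by apply: measurable_maxr => //; exact: measurable_l2norm.
have mt i : measurable_fun setT (fun t => prox_log a b w0 (f t) (h t) i).
  apply: measurable_funM => //; apply: measurable_funB => //.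
  apply: measurable_funD => //; apply: measurable_funM => //.
  exact: measurableT_comp (@measurable_ln R) _.
apply/measurable_cVP => i; under eq_fun do rewrite mxE.
case: (w0.2 i 0 == 0); first exact: measurable_cst.
apply: (measurableT_comp (@measurable_expR R)); apply: measurable_funB => //.
apply: (measurableT_comp (@measurable_ln R)).
under eq_fun do rewrite big_mkcond.
apply: measurable_sum => j; case: (w0.2 j 0 != 0) => //.
exact: measurableT_comp.
Qed.

End measurability.

Section domain_measurable.
Context {R : realType} {n m : nat}.

Lemma measurable_domain : measurable (@domain R n m).
Proof.
apply: measurableX.
- rewrite (_ : @l2ball R n = setT `&` (fun x => l2norm x <= 1) @^-1` [set true]).
    by apply: measurable_fun_ler => //; exact: measurable_l2norm.
  by rewrite setTI.
- rewrite (_ : @simplex R m = \bigcap_(i in [set: 'I_m]) (setT `&` (fun x : 'cV[R]_m =>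
  0 <= x i 0) @^-1` [set true])
     `&` (setT `&` (fun x : 'cV[R]_m => \sum_i x i 0 == 1) @^-1` [set true])).
    apply: measurableI.
      apply: fin_bigcap_measurable => // i _.
      by apply: measurable_fun_ler => //; exact: measurable_cV_coord.
    apply: measurable_fun_eqr => //; apply: measurable_sum => i.
    exact: measurable_cV_coord.
  apply/seteqP; split=> [x /simplexP[x0 x1]|x [x0 [_ /eqP x1]]].
    by split=> [i _|]; split=> //=; [exact: x0|rewrite x1 eqxx].
  by apply/simplexP; split=> // i; have [] := x0 i I.
Qed.

End domain_measurable.

(** * Measurability of Lipschitz functions on a measurable set *)

Section lipschitz_measurable.
Context {R : realType} {n m : nat}.
Implicit Types z : zspace R n m.

Lemma znorm_le_coord z (e : R) : 0 <= e ->
  (forall i, `|z.1 i 0| <= e) -> (forall i, `|z.2 i 0| <= e) ->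
  znorm z <= (n + m)%:R * e.
Proof.
move=> e0 z1 z2.
have h1 : l2norm z.1 ^+ 2 <= (n%:R * e) ^+ 2.
  rewrite l2norm_sqr exprMn.
  apply: (@le_trans _ _ (n%:R * e ^+ 2)).
    rewrite mulr_natl -[X in _ *+ X]card_ord -sumr_const; apply: ler_sum => i _.
    by rewrite -real_normK ?num_real// ler_pXn2r// nnegrE.
  by rewrite ler_wpM2r ?sqr_ge0// -natrX ler_nat; case: (n) => // k;
    rewrite -mulnn leq_pmulr.
have h2 : l1norm z.2 ^+ 2 <= (m%:R * e) ^+ 2.
  rewrite ler_pXn2r ?nnegrE ?l1norm_ge0 ?mulr_ge0//.
  by rewrite mulr_natl -[X in _ *+ X]card_ord -sumr_const; exact: ler_sum.
rewrite -[leRHS]ger0_norm ?mulr_ge0// -sqrtr_sqr ler_wsqrtr//.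
apply: (le_trans (lerD h1 h2)); rewrite natrD mulrDl sqrrD.
by rewrite -addrA lerD2l lerDr mulrn_wge0// !mulr_ge0.
Qed.

(** [f] is the limit of functions that are constant on the cells of finer and
    finer grids. *)
Lemma measurable_lipschitz (D : set (zspace R n m)) (f : zspace R n m -> R) (K : R) :
  measurable D -> 0 <= K ->
  (forall z z', D z -> D z' -> `|f z - f z'| <= K * znorm (z - z')) ->
  measurable_fun D f.
Proof.
move=> mD K0 fK.
pose N k : R := k.+1%:R.
pose cell k z : 'cV[int]_n * 'cV[int]_m :=
  (\col_i Num.floor (z.1 i 0 * N k), \col_i Num.floor (z.2 i 0 * N k)).
(* The representative of a cell is an arbitrary choice; as there are countably many cells, [F k]
   composed with [cell k] is measurable all the same. *)
pose F k c := f (xget 0 [set z | D z /\ cell k z = c]).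
have m1 i : measurable_fun setT (fun z => z.1 i 0).
  by have /measurable_zP[+ _] := @measurable_id _ (zspace R n m) setT; exact.
have m2 i : measurable_fun setT (fun z => z.2 i 0).
  by have /measurable_zP[_ +] := @measurable_id _ (zspace R n m) setT; exact.
have mfl k (h : zspace R n m -> R) c : measurable_fun setT h ->
    measurable [set z | Num.floor (h z * N k) = c].
  move=> mh; rewrite (_ : [set _ | _] = setT `&`
    (fun z => (c%:~R <= h z * N k) && (h z * N k < (c + 1)%:~R)) @^-1` [set true]).
    apply: measurable_and => //.
      by apply: measurable_fun_ler => //; exact: measurable_funM.
    by apply: measurable_fun_ltr => //; exact: measurable_funM.
  by rewrite setTI; apply/seteqP; split=> z /=; rewrite -floor_eq => /eqP.
have mcell k c : measurable [set z | cell k z = c].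
  pose A := \bigcap_(i in [set: 'I_n]) [set z : zspace R n m | Num.floor (z.1 i 0 * N
      k) = c.1 i 0].
  pose B := \bigcap_(i in [set: 'I_m]) [set z : zspace R n m | Num.floor (z.2 i 0 * N
      k) = c.2 i 0].
  have -> : [set z | cell k z = c] = A `&` B.
    apply/seteqP; split=> [z /= zc|z [z1 z2]].
      by split=> i _; rewrite /= -zc mxE.
    rewrite /cell /= [RHS]surjective_pairing; congr (_, _); apply/matrixP => i j;
      rewrite (ord1 j) mxE; [exact: z1|exact: z2].
  by apply: measurableI; apply: fin_bigcap_measurable => // i _; exact: mfl.
apply: (@measurable_fun_cvg _ _ _ D (fun k z => F k (cell k z))).
  move=> k _ Y mY.
  rewrite (_ : _ `&` _ = \bigcup_c (D `&` [set z | cell k z = c /\ Y (F k c)])).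
    apply: countable_bigcupT_measurable => [|c]; first exact: countableP.
    apply: measurableI => //.
    have [Yc|Yc] := pselect (Y (F k c)).
      by rewrite [X in measurable X](_ : _ = [set z | cell k z = c])//; apply/seteqP;
        split=> z //= [].
    by rewrite [X in measurable X](_ : _ = set0)//; apply/seteqP; split=> z //= [].
  apply/seteqP; split=> [z [Dz Yz]|z [c _ [Dz [/= <- Yz]]]] //.
  by exists (cell k z).
move=> z Dz; apply/cvgrPdist_le => e e0.
(* Points of one cell differ by at most [1 / (k + 1)] in each coordinate, and this index ensures
   [K (n + m) / (k + 1) <= e]. *)
exists (Num.truncn (K * (n + m)%:R / e)) => // k /= Nk.
have : D (xget 0 [set z' | D z' /\ cell k z' = cell k z]) /\
    cell k (xget 0 [set z' | D z' /\ cell k z' = cell k z]) = cell k z.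
  by apply: (@xgetPex _ 0 [set z' | D z' /\ cell k z' = cell k z]); exists z.
rewrite /F; set z' := xget _ _ => -[Dz' zz'].
have N0 : 0 < N k by rewrite ltr0n.
have fl (x y : R) : Num.floor (x * N k) = Num.floor (y * N k) -> `|y - x| <= (N k)^-1.
  move=> xy; have /andP[x1 x2] := floor_itv (x * N k).
  have /andP[y1 y2] := floor_itv (y * N k).
  rewrite -xy in y1 y2; rewrite intrD in x2 y2.
  rewrite -[leRHS]mul1r ler_pdivlMr// -[X in `|_| * X]gtr0_norm// -normrM mulrBl.
  by rewrite ler_norml; apply/andP; split; lra.
apply: (le_trans (fK _ _ Dz Dz')).
apply: (@le_trans _ _ (K * ((n + m)%:R * (N k)^-1))).
  rewrite ler_wpM2l// znorm_le_coord ?invr_ge0 ?(ltW N0)// => i; rewrite !mxE;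
    apply: fl.
    by have /(congr1 (fun c : zspace int n m => c.1 i 0)) := zz'; rewrite /= !mxE.
  by have /(congr1 (fun c : zspace int n m => c.2 i 0)) := zz'; rewrite /= !mxE.
rewrite mulrA ler_pdivrMr// [leRHS]mulrC -ler_pdivrMr// /N.
apply: ltW; apply: lt_le_trans (truncnS_gt _) _; rewrite ler_nat ltnS.
exact: Nk.
Qed.

End lipschitz_measurable.

(** * Independence of a seed-driven chain from its next seed *)

Section independence.
Context {R : realType} {dE dS dO : measure_display}.
Context {E : measurableType dE} {S : measurableType dS} {Omega : measurableType dO}.
Variables (mu : probability S R) (P : probability Omega R).

(** [nu] is a general measure because the induction on the chain applies this to [P] restricted to
    an event. *)
Lemma pushforward_pair (nu : {measure set Omega -> \bar R})
    (m1 : {sigma_finite_measure set E -> \bar R})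
    (m2 : {sigma_finite_measure set S -> \bar R}) (W : Omega -> E) (X : Omega -> S) :
  measurable_fun setT W -> measurable_fun setT X ->
  (forall C A, measurable C -> measurable A ->
     nu (W @^-1` C `&` X @^-1` A) = m1 C * m2 A)%E ->
  forall B, measurable B ->
    nu ((fun o => (W o, X o)) @^-1` B) = (m1 \x m2)%E B.
Proof.
move=> mW mX nuE B mB; have mWX := measurable_fun_pair mW mX.
pose WX : {mfun Omega >-> (E * S)%type} := mfun_Sub (mem_set mWX).
by rewrite (@product_measure_unique _ _ _ _ _ m1 m2 (pushforward nu WX)).
Qed.

Section integral.
Variables (W : Omega -> E) (X : Omega -> S).
Hypotheses (mW : measurable_fun setT W) (mX : measurable_fun setT X).
Hypothesis joint : forall C A, measurable C -> measurable A ->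
  (P (W @^-1` C `&` X @^-1` A) = P (W @^-1` C) * mu A)%E.

Lemma ge0_integral_independent (f : E * S -> \bar R) :
  measurable_fun setT f -> (forall x, 0 <= f x)%E ->
  (\int[P]_o f (W o, X o) = \int[P]_o \int[mu]_s f (W o, s))%E.
Proof.
move=> mf f0; have mWX := measurable_fun_pair mW mX.
pose W' : {mfun Omega >-> E} := mfun_Sub (mem_set mW).
pose WX : {mfun Omega >-> (E * S)%type} := mfun_Sub (mem_set mWX).
have := @ge0_integral_distribution _ _ _ _ _ P WX f mf f0.
rewrite /comp /= => <-.
have := @ge0_integral_distribution _ _ _ _ _ P W' (fubini_F mu f).
rewrite /comp /= => <-; last 2 first.
- exact: measurable_fun_fubini_tonelli_F.
- by move=> x; exact: integral_ge0.
rewrite -fubini_tonelli1//; apply: eq_measure_integral => B mB _.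
exact: (@pushforward_pair P (distribution P W') mu).
Qed.

(** The bound [K], uniform in the first argument, gives integrability by Tonelli; the identity then
    holds for the positive and negative parts separately. *)
Lemma integral_independent (f : E * S -> R) (K : R) : measurable_fun setT f ->
  (forall o, \int[mu]_s `|f (W o, s)|%:E <= K%:E)%E ->
  P.-integrable setT (fun o => (f (W o, X o))%:E) /\
  (\int[P]_o (f (W o, X o))%:E = \int[P]_o \int[mu]_s (f (W o, s))%:E)%E.
Proof.
move=> mf fK.
have mWX := measurable_fun_pair mW mX.
have mfe : measurable_fun setT (EFin \o f) by exact/measurable_EFinP.
have mfa : measurable_fun setT (fun x => `|(f x)%:E|%E).
  by apply: measurableT_comp mfe.
have int1 : (\int[P]_o `|(f (W o, X o))%:E| <= K%:E)%E.
  have := @ge0_integral_independent (fun x => `|(f x)%:E|%E).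
  rewrite /= => /(_ mfa) ->//.
  have -> : K%:E = (\int[P]_o (cst K%:E) o)%E.
    by rewrite integral_cst//= probability_setT mule1.
  apply: ge0_le_integral => //.
  - by move=> o _; exact: integral_ge0.
  - have mF := @measurable_fun_fubini_tonelli_F _ _ _ _ _ mu (fun x => `|(f x)%:E|%E).
    exact: (measurableT_comp (mF _ _) mW).
have intf : P.-integrable setT (fun o => (f (W o, X o))%:E).
  apply/integrableP; split; first exact: (measurableT_comp mfe mWX).
  by apply: le_lt_trans int1 _; rewrite ltry.
split=> //.
pose fp := (EFin \o f)^\+%E; pose fn := (EFin \o f)^\-%E.
have mfp : measurable_fun setT fp by exact: measurable_funepos.
have mfn : measurable_fun setT fn by exact: measurable_funeneg.
have mF h : measurable_fun setT h -> (forall x, 0 <= h x)%E ->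
    measurable_fun setT (fun o => \int[mu]_s h (W o, s))%E.
  move=> mh h0; exact: (measurableT_comp (@measurable_fun_fubini_tonelli_F _ _ _ _ _ mu
    _ mh h0) mW).
have intF h : measurable_fun setT h -> (forall x, 0 <= h x)%E ->
    (forall x, h x <= `|f x|%:E)%E ->
    P.-integrable setT (fun o => \int[mu]_s h (W o, s))%E.
  move=> mh h0 hf; apply/integrableP; split; first exact: mF.
  apply: (@le_lt_trans _ _ (\int[P]_o (cst K%:E) o)%E); last first.
    by rewrite integral_cst//= probability_setT mule1 ltry.
  apply: ge0_le_integral => //.
  - by apply: measurableT_comp => //; exact: mF.
  - move=> o _; rewrite gee0_abs; last exact: integral_ge0.
    apply: le_trans (fK o); apply: ge0_le_integral => //.
    + exact: (measurableT_comp mh (pair1_measurable _)).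
    + apply/measurable_EFinP; apply: measurableT_comp => //.
      exact: (measurableT_comp mf (pair1_measurable _)).
have fpf x : (fp x <= `|f x|%:E)%E.
  by rewrite /fp funeposE ge_max !lee_fin ler_norm normr_ge0.
have fnf x : (fn x <= `|f x|%:E)%E.
  by rewrite /fn funenegE ge_max -EFinN !lee_fin -normrN ler_norm normr_ge0.
rewrite integralE.
have -> : (\int[P]_o (fun o => (f (W o, X o))%:E)^\+%E o = \int[P]_o fp (W o, X o))%E.
  by apply: eq_integral => o _; rewrite /fp !funeposE.
have -> : (\int[P]_o (fun o => (f (W o, X o))%:E)^\-%E o = \int[P]_o fn (W o, X o))%E.
  by apply: eq_integral => o _; rewrite /fn !funenegE.
have fp0 x : (0 <= fp x)%E by exact: funepos_ge0.
have fn0 x : (0 <= fn x)%E by exact: funeneg_ge0.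
rewrite !ge0_integral_independent//.
have ifp := intF _ mfp fp0 fpf; have ifn := intF _ mfn fn0 fnf.
rewrite -integralB//.
apply: eq_integral => o _; rewrite [RHS]integralE; congr (_ - _)%E;
  by apply: eq_integral => s _; rewrite /fp /fn ?funeposE ?funenegE.
Qed.
End integral.

Variables (T : nat) (X : nat -> {RV P >-> S}) (X_iid : iid_seeds mu T X).
Variables (Phi : E * S -> E) (W : nat -> Omega -> E) (e0 : E).
Hypotheses (mPhi : measurable_fun setT Phi) (W_0 : W 0%N = cst e0).
Hypothesis W_S : forall t o, W t.+1 o = Phi (W t o, X t o).

Lemma measurable_chain t : measurable_fun setT (W t).
Proof.
elim: t => [|t IH]; first by rewrite W_0.
rewrite (_ : W t.+1 = Phi \o (fun o => (W t o, X t o))).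
  by apply: measurableT_comp => //; exact: measurable_fun_pair.
by apply/funext => o; rewrite W_S.
Qed.

Let future (A : nat -> set S) t :=
  \bigcap_(k in [set k | (t <= k < T)%N]) X k @^-1` A k.

(** The induction must carry all seeds still to come: [W t.+1] uses up [X t], and its independence
    of the later seeds rests on that of [W t] from [X t] and the later seeds jointly. *)
Lemma chain_independent_future t (C : set E) (A : nat -> set S) :
  (t <= T)%N -> measurable C -> (forall k, measurable (A k)) ->
  (P (W t @^-1` C `&` future A t)
   = P (W t @^-1` C) * (\prod_(t <= k < T) fine (mu (A k)))%:E)%E.
Proof.
have [X_law X_prod] := X_iid.
elim: t C A => [|t IH] C A tT mC mA.
  have fE : P (future A 0) = (\prod_(0 <= k < T) fine (mu (A k)))%:E.
    rewrite /future (X_prod _ mA) (big_morph EFin EFinM erefl) big_mkord.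
    apply: eq_bigr => k _; rewrite fineK ?fin_num_measure//.
    by rewrite -(X_law k).
  rewrite W_0 preimage_cst; case: ifP => _.
    by rewrite setTI fE probability_setT mul1e.
  by rewrite set0I measure0 mul0e.
have mfut B s : (forall k, measurable (B k)) -> measurable (future B s).
  move=> mB; apply: fin_bigcap_measurable => [|k _].
    by apply: (@sub_finite_set _ _ `I_T) => // k /= /andP[].
  by rewrite -[X in measurable X]setTI; exact: measurable_funPT.
have mW := measurable_chain t.
pose W' : {mfun Omega >-> E} := mfun_Sub (mem_set mW).
(* On rectangles this is the induction hypothesis with a constraint on [X t] added. Uniqueness of
   the product measure, for [P] restricted to the future event, extends it to every measurable [D],
   in particular to the preimage of [C] under [Phi]. *)
have key B (D : set (E * S)) : (forall k, measurable (B k)) -> measurable D ->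
    (P ((fun o => (W t o, X t o)) @^-1` D `&` future B t.+1)
     = (distribution P W' \x mu) D * (\prod_(t.+1 <= k < T) fine (mu (B k)))%:E)%E.
  move=> mB mD.
  have c0 : 0 <= \prod_(t.+1 <= k < T) fine (mu (B k)).
    by apply: prodr_ge0 => k _; rewrite fine_ge0.
  pose c := NngNum c0.
  have H := @pushforward_pair (mrestr P (mfut B t.+1 mB)) (distribution P W') (mscale c
      mu) (W t) (X t) mW.
  transitivity ((distribution P W' \x mscale c mu)%E D).
    rewrite -H// => C' A' mC' mA'.
    rewrite /mrestr/= /mscale/= /distribution/= /pushforward/=.
    pose B' k := if k == t then A' else B k.
    have mB' k : measurable (B' k) by rewrite /B'; case: ifP.
    transitivity (P (W t @^-1` C' `&` X t @^-1` A' `&` future B t.+1)); first by [].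
    have -> : W t @^-1` C' `&` X t @^-1` A' `&` future B t.+1
        = W t @^-1` C' `&` future B' t.
      rewrite -setIA; congr (_ `&` _); apply/seteqP;
        split=> [p [Xp fp] k /andP[tk kT]|p fp].
        rewrite /B'; case: eqVneq => [-> |kt]; [exact: Xp|apply: fp => /=].
        by rewrite kT andbT ltn_neqAle eq_sym kt.
      split; first by have := fp t; rewrite /= leqnn tT /B' eqxx; exact.
      move=> k /= /andP[tk kT]; have := fp k; rewrite /= (ltnW tk) kT /B' gtn_eqF//.
      exact.
    rewrite IH ?(ltnW tT)// big_ltn// EFinM {1}/B' eqxx fineK ?fin_num_measure//.
    congr (_ * _)%E; rewrite muleC; congr (_%:E * _)%E.
    by apply: eq_big_nat => k /andP[tk _]; rewrite /B' gtn_eqF.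
  rewrite muleC.
  rewrite (@product_measure_unique _ _ _ _ _ (distribution P W') (mscale c mu) (mscale
    c (distribution P W' \x mu)%E))//.
  move=> C' A' mC' mA'.
  transitivity (c%:num%:E * (distribution P W' \x mu) (C' `*` A'))%E; first by [].
  by rewrite product_measure1E// muleCA.
have mD : measurable (Phi @^-1` C) by rewrite -[X in measurable X]setTI; exact: mPhi.
have WSE : W t.+1 @^-1` C = (fun o => (W t o, X t o)) @^-1` (Phi @^-1` C).
  by apply/seteqP; split=> p /=; rewrite W_S.
have fut1 : future (fun=> setT) t.+1 = setT by apply/seteqP; split=> // p _ k.
(* With an unconstrained future, [key] identifies the product measure with the probability that
   [W t.+1] lies in [C]. *)
have := key (fun=> setT) _ (fun=> measurableT) mD.
rewrite fut1 setIT big1 => [PE|k _]; last by rewrite probability_setT.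
by rewrite WSE (key A _ mA mD) PE mule1.
Qed.

Lemma chain_independent t (C : set E) (A : set S) : (t < T)%N ->
  measurable C -> measurable A ->
  (P (W t @^-1` C `&` X t @^-1` A) = P (W t @^-1` C) * mu A)%E.
Proof.
move=> tT mC mA; pose B k := if k == t then A else setT.
have mB k : measurable (B k) by rewrite /B; case: ifP.
have := chain_independent_future (ltnW tT) mC mB.
rewrite big_ltn// {2}/B eqxx big_nat big1 => [|k /andP[tk _]]; last first.
  by rewrite /B gtn_eqF// probability_setT.
rewrite mulr1 fineK ?fin_num_measure// => <-; congr (P (_ `&` _)).
apply/seteqP; split=> [p Ap k _|p fp]; first by rewrite /B; case: eqVneq => [->|].
by have := fp t; rewrite /= leqnn tT /B eqxx; exact.
Qed.
End independence.

(** * Real-valued means and the mean of the second-order gap *)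

Section mean.
Context {R : realType} {dS : measure_display} {S : measurableType dS}.
Variable mu : probability S R.
Implicit Types f h Y : S -> R.

Definition summable_rv f := mu.-integrable setT (EFin \o f).
Definition mean f : R := \int[mu]_s f s.

Lemma summable_rv_measurable f : summable_rv f -> measurable_fun setT f.
Proof. by move=> /integrableP[/measurable_EFinP]. Qed.

Lemma meanE f : summable_rv f -> (\int[mu]_s (f s)%:E = (mean f)%:E)%E.
Proof. by move=> sf; rewrite fineK// integrable_fin_num. Qed.

Lemma summable_rv_cst (c : R) : summable_rv (cst c).
Proof. exact: finite_measure_integrable_cst. Qed.

Lemma mean_cst (c : R) : mean (cst c) = c.
Proof. by rewrite /mean Rintegral_cst//= probability_setT mulr1. Qed.

Lemma summable_rvD f h : summable_rv f -> summable_rv h ->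
  summable_rv (fun s => f s + h s).
Proof. by move=> sf sh; exact: (integrableD measurableT sf sh). Qed.

Lemma summable_rvB f h : summable_rv f -> summable_rv h ->
  summable_rv (fun s => f s - h s).
Proof. by move=> sf sh; exact: (integrableB measurableT sf sh). Qed.

Lemma summable_rvZ (c : R) f : summable_rv f -> summable_rv (fun s => c * f s).
Proof. by move=> sf; exact: (integrableZl measurableT c sf). Qed.

Lemma summable_rv_sum (I : Type) (r : seq I) (F : I -> S -> R) :
  (forall i, summable_rv (F i)) -> summable_rv (fun s => \sum_(i <- r) F i s).
Proof.
move=> sF; elim: r => [|i r IH].
  by under eq_fun do rewrite big_nil; exact: summable_rv_cst.
by under eq_fun do rewrite big_cons; exact: summable_rvD.
Qed.

Lemma meanD f h : summable_rv f -> summable_rv h ->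
  mean (fun s => f s + h s) = mean f + mean h.
Proof. exact: RintegralD. Qed.

Lemma meanB f h : summable_rv f -> summable_rv h ->
  mean (fun s => f s - h s) = mean f - mean h.
Proof. exact: RintegralB. Qed.

Lemma meanZ (c : R) f : summable_rv f -> mean (fun s => c * f s) = c * mean f.
Proof. exact: RintegralZl. Qed.

Lemma mean_sum (I : Type) (r : seq I) (F : I -> S -> R) :
  (forall i, summable_rv (F i)) ->
  mean (fun s => \sum_(i <- r) F i s) = \sum_(i <- r) mean (F i).
Proof.
move=> sF; elim: r => [|i r IH].
  by under [X in mean X]eq_fun do rewrite big_nil; rewrite big_nil mean_cst.
under [X in mean X]eq_fun do rewrite big_cons.
by rewrite big_cons meanD ?IH//; exact: summable_rv_sum.
Qed.

Lemma le_mean f h : summable_rv f -> summable_rv h -> (forall s, f s <= h s) ->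
  mean f <= mean h.
Proof. by move=> sf sh fh; apply: le_Rintegral. Qed.

Lemma mean_ge0 f : (forall s, 0 <= f s) -> 0 <= mean f.
Proof. by move=> f0; exact: Rintegral_ge0. Qed.

Lemma summable_rv_le f h : measurable_fun setT f -> summable_rv h ->
  (forall s, `|f s| <= h s) -> summable_rv f.
Proof.
move=> mf sh fh; apply: (le_integrable measurableT _ _ sh).
  exact/measurable_EFinP.
by move=> s _; rewrite lee_fin (le_trans (fh s))// ler_norm.
Qed.

Lemma summable_rv_ae_le f h : measurable_fun setT f -> (forall s, 0 <= f s) ->
  summable_rv h -> (forall s, 0 <= h s) -> {ae mu, forall s, f s <= h s} ->
  summable_rv f /\ mean f <= mean h.
Proof.
move=> mf f0 sh h0 fh.
have mh := summable_rv_measurable sh.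
have le : (\int[mu]_s (f s)%:E <= \int[mu]_s (h s)%:E)%E.
  apply: ae_ge0_le_integral => //; try exact/measurable_EFinP.
  - by move=> s _; rewrite lee_fin.
  - by move=> s _; rewrite lee_fin.
  - by apply: filterS fh => s fh _; rewrite lee_fin.
have sf : summable_rv f.
  apply/integrableP; split; first exact/measurable_EFinP.
  under eq_integral do rewrite /= ger0_norm//.
  by apply: le_lt_trans le _; rewrite meanE// ltry.
by split=> //; rewrite -lee_fin -!meanE.
Qed.

(** Integrability comes from [|Y| <= 1 + Y^2], the bounds from [E (Y - E Y)^2 = E Y^2 - (E Y)^2]. *)
Lemma variance_le Y : measurable_fun setT Y -> summable_rv (fun s => Y s ^+ 2) ->
  [/\ summable_rv Y, summable_rv (fun s => (Y s - mean Y) ^+ 2),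
   mean (fun s => (Y s - mean Y) ^+ 2) <= mean (fun s => Y s ^+ 2)
   & mean Y ^+ 2 <= mean (fun s => Y s ^+ 2)].
Proof.
move=> mY sY2.
have sY : summable_rv Y.
  apply: (@summable_rv_le _ (fun s => 1 + Y s ^+ 2)) => //.
    exact: (summable_rvD (summable_rv_cst 1)).
  move=> s; rewrite -[Y s ^+ 2]real_normK ?num_real//.
  by have := sqr_ge0 (`|Y s| - 1); nra.
have e s : (Y s - mean Y) ^+ 2 = Y s ^+ 2 + (- 2 * mean Y * Y s + mean Y ^+ 2) by ring.
have sl : summable_rv (fun s => - 2 * mean Y * Y s + mean Y ^+ 2).
  by apply: summable_rvD; [exact: summable_rvZ|exact: summable_rv_cst].
have sd : summable_rv (fun s => (Y s - mean Y) ^+ 2).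
  by under eq_fun do rewrite e; exact: summable_rvD.
have md : mean (fun s => (Y s - mean Y) ^+ 2)
    = mean (fun s => Y s ^+ 2) - mean Y ^+ 2.
  under [X in mean X]eq_fun do rewrite e.
  rewrite meanD// (@meanD (fun s => - 2 * mean Y * Y s) (cst (mean Y ^+ 2))).
  - by rewrite meanZ// mean_cst; ring.
  - exact: summable_rvZ.
  - exact: summable_rv_cst.
split=> //; first by rewrite md gerBl sqr_ge0.
by rewrite -subr_ge0 -md mean_ge0// => s; exact: sqr_ge0.
Qed.

Context {n m : nat}.

(** [p] is deterministic, so the mean passes through the weights [p.2], which sum to 1, and a bound
    for each single coordinate suffices. *)
Lemma mean_second_order_gap (p : zspace R n m) (gam : S -> zspace R n m) (B : R) :
  @simplex R m p.2 -> measurable_fun setT gam ->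
  summable_rv (fun s => l2norm (gam s).1 ^+ 2) ->
  (forall i, summable_rv (fun s => (gam s).2 i 0 ^+ 2)) ->
  (forall i, {ae mu, forall s, `|(gam s).2 i 0| <= 2}) ->
  (forall i, mean (fun s => l2norm (gam s).1 ^+ 2)
     + mean (fun s => (gam s).2 i 0 ^+ 2) <= B) ->
  summable_rv (fun s => second_order_gap p (gam s)) /\
  mean (fun s => second_order_gap p (gam s)) <= 3 / 2 * B.
Proof.
move=> /simplexP[p0 p1] mg s1 s2 ae2 le_B.
have [_ mg2] := (measurable_zP gam).1 mg.
have gap i : summable_rv (fun s => expR (- (gam s).2 i 0) - 1 + (gam s).2 i 0) /\
    mean (fun s => expR (- (gam s).2 i 0) - 1 + (gam s).2 i 0)
      <= mean (fun s => 3 / 2 * (gam s).2 i 0 ^+ 2).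
  apply: summable_rv_ae_le.
  - apply: measurable_funD => //; apply: measurable_funB => //.
    by apply: measurableT_comp => //; exact: measurable_funN.
  - by move=> s; have := expR_ge1Dx (- (gam s).2 i 0); lra.
  - exact: summable_rvZ.
  - by move=> s; rewrite mulr_ge0 ?sqr_ge0.
  - have := ae2 i; apply: filterS => s h.
    have := @expR_le_quadratic R (- (gam s).2 i 0).
    by rewrite normrN sqrrN => /(_ h); lra.
rewrite /second_order_gap; split.
  apply: summable_rvD; first exact: summable_rvZ.
  by apply: summable_rv_sum => i; apply: summable_rvZ; exact: (gap i).1.
rewrite meanD; first last.
- by apply: summable_rv_sum => i; apply: summable_rvZ; exact: (gap i).1.
- exact: summable_rvZ.
rewrite meanZ// mean_sum => [|i]; last by apply: summable_rvZ; exact: (gap i).1.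
have q0 : 0 <= mean (fun s => l2norm (gam s).1 ^+ 2).
  by apply: mean_ge0 => s; exact: sqr_ge0.
set q := mean _ in le_B q0 *.
(* Each second moment of a coordinate is at most [B - q]; the intermediate value equals
   [3/2 B - q]. *)
apply: (@le_trans _ _ (2^-1 * q + \sum_i p.2 i 0 * (3 / 2 * (B - q)))); last first.
  by rewrite -mulr_suml p1; lra.
rewrite lerD2l; apply: ler_sum => i _.
rewrite meanZ; last exact: (gap i).1.
rewrite ler_wpM2l// (le_trans (gap i).2)// meanZ//.
by have := le_B i; lra.
Qed.

End mean.

(** * Random vectors with bounded moments and their centering *)

Section random_vector.
Context {R : realType} {dS : measure_display} {S : measurableType dS}.
Variable mu : probability S R.
Context {n m : nat}.

Lemma measurable_mean dE (E : measurableType dE) (F : E * S -> R) :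
  measurable_fun setT F -> measurable_fun setT (fun e => mean mu (fun s => F (e, s))).
Proof.
move=> mF; have mFe : measurable_fun setT (EFin \o F) by exact/measurable_EFinP.
apply: measurableT_comp; first exact: fine_measurable.
under eq_fun do rewrite integralE.
apply: emeasurable_funB.
- rewrite (_ : (fun _ => _) = fubini_F mu (EFin \o F)^\+%E).
    by apply: measurable_fun_fubini_tonelli_F => //; exact: measurable_funepos.
  by apply/funext => e; apply: eq_integral => s _; rewrite !funeposE.
- rewrite (_ : (fun _ => _) = fubini_F mu (EFin \o F)^\-%E).
    by apply: measurable_fun_fubini_tonelli_F => //; exact: measurable_funeneg.
  by apply/funext => e; apply: eq_integral => s _; rewrite !funenegE.
Qed.

Definition mean_vec (D : S -> zspace R n m) : zspace R n m :=
  (\col_i mean mu (fun s => (D s).1 i 0), \col_i mean mu (fun s => (D s).2 i 0)).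

(** [bm_le] pairs the first block with one coordinate at a time: this expresses a maximum over
    coordinates taken outside the mean. *)
Record bounded_moments (D : S -> zspace R n m) (tau B : R) := BoundedMoments {
  bm_measurable : measurable_fun setT D;
  bm_summable1 : summable_rv mu (fun s => l2norm (D s).1 ^+ 2);
  bm_summable2 : forall i, summable_rv mu (fun s => (D s).2 i 0 ^+ 2);
  bm_bounded : forall i, {ae mu, forall s, `|(D s).2 i 0| <= tau};
  bm_le : forall i, mean mu (fun s => l2norm (D s).1 ^+ 2)
     + mean mu (fun s => (D s).2 i 0 ^+ 2) <= B }.

Lemma bounded_momentsZ (D : S -> zspace R n m) (tau B c : R) :
  bounded_moments D tau B ->
  bounded_moments (fun s => c *: D s) (`|c| * tau) (c ^+ 2 * B).
Proof.
move=> [mD s1 s2 bD leB].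
have e1 s : l2norm (c *: D s).1 ^+ 2 = c ^+ 2 * l2norm (D s).1 ^+ 2.
  by rewrite !l2norm_sqr mulr_sumr; apply: eq_bigr => i _; rewrite mxE exprMn.
have e2 i s : (c *: D s).2 i 0 ^+ 2 = c ^+ 2 * (D s).2 i 0 ^+ 2.
  by rewrite mxE exprMn.
split.
- exact: measurable_zZ.
- by under eq_fun do rewrite e1; exact: summable_rvZ.
- by move=> i; under eq_fun do rewrite e2; exact: summable_rvZ.
- move=> i; apply: filterS (bD i) => s h.
  by rewrite mxE normrM ler_wpM2l.
- move=> i; under [X in mean _ X + _]eq_fun do rewrite e1.
  under [X in _ + mean _ X]eq_fun do rewrite e2.
  by rewrite !meanZ// -mulrDr ler_wpM2l ?sqr_ge0.
Qed.

Lemma bounded_moments_gap (D : S -> zspace R n m) (B : R) (p : zspace R n m) :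
  bounded_moments D 2 B -> @simplex R m p.2 ->
  summable_rv mu (fun s => second_order_gap p (D s)) /\
  mean mu (fun s => second_order_gap p (D s)) <= 3 / 2 * B.
Proof. by case=> *; exact: mean_second_order_gap. Qed.

Lemma bounded_momentsW (D : S -> zspace R n m) (tau tau' B : R) : tau <= tau' ->
  bounded_moments D tau B -> bounded_moments D tau' B.
Proof.
move=> tt' [mD s1 s2 bD leB]; split=> // i.
by apply: filterS (bD i) => s h; exact: le_trans tt'.
Qed.

Section centered.
Variables (D : S -> zspace R n m) (tau B : R).
Hypotheses (tau_ge0 : 0 <= tau) (bmD : bounded_moments D tau B).
Let e := mean_vec D.

Let m1 i : measurable_fun setT (fun s => (D s).1 i 0).
Proof. by have [+ _] := (measurable_zP D).1 (bm_measurable bmD); exact. Qed.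
Let m2 i : measurable_fun setT (fun s => (D s).2 i 0).
Proof. by have [_ +] := (measurable_zP D).1 (bm_measurable bmD); exact. Qed.

Let s1 i : summable_rv mu (fun s => (D s).1 i 0 ^+ 2).
Proof.
apply: summable_rv_le (bm_summable1 bmD) _; first exact: measurable_funX.
move=> s; rewrite ger0_norm ?sqr_ge0// l2norm_sqr (bigD1 i)//= lerDl.
by apply: sumr_ge0 => j _; exact: sqr_ge0.
Qed.

Let v1 i := variance_le (m1 i) (s1 i).
Let v2 i := variance_le (m2 i) (bm_summable2 bmD i).

Let l2norm_mean : mean mu (fun s => l2norm (D s).1 ^+ 2)
  = \sum_i mean mu (fun s => (D s).1 i 0 ^+ 2).
Proof.
under [X in mean _ X]eq_fun do rewrite l2norm_sqr.
by rewrite mean_sum.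
Qed.

Lemma mean_vec_bounded i : `|e.2 i 0| <= tau.
Proof.
have [_ _ _ le2] := v2 i.
have [_ le3] : summable_rv mu (fun s => (D s).2 i 0 ^+ 2) /\
    mean mu (fun s => (D s).2 i 0 ^+ 2) <= mean mu (cst (tau ^+ 2)).
  apply: summable_rv_ae_le => //.
  - exact: measurable_funX.
  - by move=> s; exact: sqr_ge0.
  - exact: summable_rv_cst.
  - by move=> s; exact: sqr_ge0.
  - apply: filterS (bm_bounded bmD i) => s h.
    by rewrite -[leLHS]real_normK ?num_real// ler_pXn2r// nnegrE.
rewrite mean_cst in le3.
rewrite -(@ler_pXn2r _ 2)// ?nnegrE// real_normK ?num_real// mxE.
exact: le_trans le3.
Qed.

Lemma mean_vec_moments i : l2norm e.1 ^+ 2 + e.2 i 0 ^+ 2 <= B.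
Proof.
apply: le_trans (bm_le bmD i); rewrite l2norm_mean l2norm_sqr; apply: lerD.
  by apply: ler_sum => j _; rewrite mxE; case: (v1 j).
by rewrite mxE; case: (v2 i).
Qed.

(** A variance is at most the second moment, so [B] is kept; the almost sure bound doubles, as the
    mean obeys it too. *)
Lemma centered_moments : bounded_moments (fun s => e - D s) (2 * tau) B.
Proof.
have h1 i s : (e - D s).1 i 0 ^+ 2 = ((D s).1 i 0
    - mean mu (fun s => (D s).1 i 0)) ^+ 2.
  by rewrite !mxE -sqrrN opprB.
have h2 i s : (e - D s).2 i 0 ^+ 2 = ((D s).2 i 0
    - mean mu (fun s => (D s).2 i 0)) ^+ 2.
  by rewrite !mxE -sqrrN opprB.
have hl s : l2norm (e - D s).1 ^+ 2 = \sum_i ((D s).1 i 0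
    - mean mu (fun s => (D s).1 i 0)) ^+ 2.
  by rewrite l2norm_sqr; apply: eq_bigr => i _.
split.
- exact: (measurable_zB (measurable_cst e) (bm_measurable bmD)).
- by under eq_fun do rewrite hl; apply: summable_rv_sum => i; case: (v1 i).
- by move=> i; under eq_fun do rewrite h2; case: (v2 i).
- move=> i; apply: filterS (bm_bounded bmD i) => s h.
  have := mean_vec_bounded i => h'; rewrite !mxE /= in h' *.
  by apply: le_trans (ler_normB _ _) _; lra.
- move=> i; apply: le_trans (bm_le bmD i).
  under [X in mean _ X + _]eq_fun do rewrite hl.
  under [X in _ + mean _ X]eq_fun do rewrite h2.
  rewrite l2norm_mean mean_sum => [|j]; last by case: (v1 j).
  apply: lerD; last by case: (v2 i).
  by apply: ler_sum => j _; case: (v1 j).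
Qed.

Lemma mean_pairing_centered (v : zspace R n m) :
  summable_rv mu (fun s => pairing (e - D s) v) /\
  mean mu (fun s => pairing (e - D s) v) = 0.
Proof.
have c1 i : summable_rv mu (fun s => (e - D s).1 i 0 * v.1 i 0) /\
    mean mu (fun s => (e - D s).1 i 0 * v.1 i 0) = 0.
  have [sD _ _ _] := v1 i.
  have h s : (e - D s).1 i 0 * v.1 i 0 = v.1 i 0 * (mean mu (fun s => (D s).1 i 0)
      - (D s).1 i 0).
    by rewrite !mxE mulrC.
  have sc := summable_rv_cst mu (mean mu (fun s => (D s).1 i 0)).
  have sB := summable_rvB sc sD.
  have mB := meanB sc sD; rewrite mean_cst subrr in mB.
  under eq_fun do rewrite h.
  split; first exact: (summable_rvZ _ sB).
  by rewrite (meanZ _ sB) mB mulr0.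
have c2 i : summable_rv mu (fun s => (e - D s).2 i 0 * v.2 i 0) /\
    mean mu (fun s => (e - D s).2 i 0 * v.2 i 0) = 0.
  have [sD _ _ _] := v2 i.
  have h s : (e - D s).2 i 0 * v.2 i 0 = v.2 i 0 * (mean mu (fun s => (D s).2 i 0)
      - (D s).2 i 0).
    by rewrite !mxE mulrC.
  have sc := summable_rv_cst mu (mean mu (fun s => (D s).2 i 0)).
  have sB := summable_rvB sc sD.
  have mB := meanB sc sD; rewrite mean_cst subrr in mB.
  under eq_fun do rewrite h.
  split; first exact: (summable_rvZ _ sB).
  by rewrite (meanZ _ sB) mB mulr0.
have d1 := summable_rv_sum (index_enum 'I_n) (fun i => (c1 i).1).
have d2 := summable_rv_sum (index_enum 'I_m) (fun i => (c2 i).1).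
split; first exact: summable_rvD.
rewrite /pairing /dot (meanD d1 d2) (mean_sum _ (fun i => (c1 i).1)).
rewrite (mean_sum _ (fun i => (c2 i).1)) !big1 ?addr0// => i _; first exact: (c2 i).2.
exact: (c1 i).2.
Qed.
End centered.

(** Serves integrability uniformly in the state, so [|x y| <= x^2 + y^2] is precise enough. The
    factor [m.+1] counts the first block and [m] coordinates; [i0] gives access to the bound on the
    first block. *)
Lemma mean_abs_pairing (D : S -> zspace R n m) (tau B : R) (v : zspace R n m) (i0 :
    'I_m) :
  bounded_moments D tau B ->
  summable_rv mu (fun s => `|pairing (D s) v|) /\
  mean mu (fun s => `|pairing (D s) v|)
    <= B * m.+1%:R + l2norm v.1 ^+ 2 + \sum_i v.2 i 0 ^+ 2.
Proof.
case=> mD s1 s2 _ leB.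
pose b s := l2norm (D s).1 ^+ 2 + \sum_i (D s).2 i 0 ^+ 2
  + (l2norm v.1 ^+ 2 + \sum_i v.2 i 0 ^+ 2).
have dle k (x y : 'cV[R]_k) : `|dot x y| <= \sum_i x i 0 ^+ 2 + \sum_i y i 0 ^+ 2.
  apply: (le_trans (ler_norm_sum _ _ _)); rewrite -big_split; apply: ler_sum => i _ /=.
  rewrite normrM -[x i 0 ^+ 2]real_normK ?num_real// -[y i 0 ^+ 2]real_normK
    ?num_real//.
  by have := sqr_ge0 (`|x i 0| - `|y i 0|); have := sqr_ge0 `|x i 0|; have
    := sqr_ge0 `|y i 0|; nra.
have le_b s : `|pairing (D s) v| <= b s.
  apply: (le_trans (ler_normD _ _)); have := lerD (dle _ (D s).1 v.1) (dle _ (D s).2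
    v.2).
  by move/le_trans; apply; rewrite /b !l2norm_sqr; lra.
have s22 := summable_rv_sum (index_enum 'I_m) s2.
have sb : summable_rv mu b.
  apply: summable_rvD; first exact: summable_rvD.
  exact: summable_rv_cst.
have sp : summable_rv mu (fun s => `|pairing (D s) v|).
  apply: summable_rv_le sb _; last by move=> s; rewrite normr_id.
  apply: measurableT_comp => //; exact: measurable_pairing.
split=> //; apply: (le_trans (le_mean sp sb le_b)).
rewrite /b meanD; [|exact: summable_rvD|exact: summable_rv_cst].
rewrite meanD// mean_sum// mean_cst addrA !lerD2r.
set q := mean _ _ in leB *.
have q0 : 0 <= q by apply: mean_ge0 => s; exact: sqr_ge0.
have q2 i : 0 <= mean mu (fun s => (D s).2 i 0 ^+ 2).
  by apply: mean_ge0 => s; exact: sqr_ge0.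
have qB : q <= B by have := leB i0; have := q2 i0; lra.
rewrite mulrS mulrDr mulr1 lerD// mulr_natr -[X in _ *+ X]card_ord -sumr_const.
by apply: ler_sum => i _; have := leB i; lra.
Qed.
End random_vector.

(** * Diameter bounds for the domain *)

Section diameter.
Context {R : realType} {n m : nat}.
Implicit Types w u : zspace R n m.

Lemma domain_simplex w : domain w -> @simplex R m w.2.
Proof. by case. Qed.

Lemma measurable_znorm_sqr d (T : measurableType d) (f : T -> zspace R n m) :
  measurable_fun setT f -> measurable_fun setT (fun t => znorm (f t) ^+ 2).
Proof.
move=> /measurable_fun_pairP[m1 /measurable_cVP m2].
under eq_fun do rewrite sqr_sqrtr ?addr_ge0 ?sqr_ge0//.
apply: measurable_funD; apply: measurable_funX; first exact: measurable_l2norm.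
by apply: measurable_sum => i; apply: measurableT_comp => //; exact: m2.
Qed.

Lemma simplex_coord_le1 (y : 'cV[R]_m) i : simplex y -> 0 <= y i 0 <= 1.
Proof.
move=> /simplexP[y0 y1]; rewrite y0 -y1 (bigD1 i)//= lerDl.
by apply: sumr_ge0.
Qed.

Lemma l2ball_diam k (x v : 'cV[R]_k) : l2ball x -> l2ball v ->
  l2norm (x - v) ^+ 2 <= 4.
Proof.
move=> /l2ballP x1 /l2ballP v1; rewrite l2norm_sqr.
apply: (@le_trans _ _ (2 * \sum_i x i 0 ^+ 2 + 2 * \sum_i v i 0 ^+ 2)); last by lra.
rewrite !mulr_sumr -big_split; apply: ler_sum => i _; rewrite !mxE /=.
by have := sqr_ge0 (x i 0 + v i 0); lra.
Qed.

Lemma domain_diam w u : domain w -> domain u -> znorm (w - u) ^+ 2 <= 8.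
Proof.
move=> [wx wy] [ux uy]; rewrite sqr_sqrtr ?addr_ge0 ?sqr_ge0//.
have := l2ball_diam wx ux; have := simplex_l1diam wy uy.
have := l1norm_ge0 (w - u).2; rewrite /=.
set a := l1norm _ => a0 a2 b; suff : a ^+ 2 <= 4 by lra.
by rewrite (_ : 4 = 2 ^+ 2) ?ler_pXn2r ?nnegrE//; ring.
Qed.

Lemma simplex_inhabited (y : 'cV[R]_m) : simplex y -> exists i : 'I_m, True.
Proof.
case: m y => [|k] y; last by exists ord0.
by move=> /simplexP[_]; rewrite big_ord0 => /eqP; rewrite eq_sym oner_eq0.
Qed.

Lemma domain_sumsq2 w u : domain w -> domain u ->
  \sum_i (w - u).2 i 0 ^+ 2 <= m%:R.
Proof.
move=> [_ wy] [_ uy]; rewrite -[m in m%:R]card_ord -sum1_card natr_sum.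
apply: ler_sum => i _; rewrite !mxE.
have /andP[? ?] := simplex_coord_le1 i wy; have /andP[? ?] := simplex_coord_le1 i uy.
by nra.
Qed.
End diameter.

(** * Moments, bias and one-step noise of the estimator *)

Section estimator.
Context {R : realType} {n m : nat}.
Variables (alpha L : R) (alpha_gt0 : 0 < alpha) (L_gt0 : 0 < L).
Variables (w0 : zspace R n m) (w0_domain : domain w0).
Variable g : zspace R n m -> zspace R n m.
Context {d : measure_display} {S : measurableType d}.
Variables (mu : probability S R) (gt : zspace R n m -> S -> zspace R n m).
Hypothesis gt_cbb : centered_bounded_biased mu w0 L (24 * L ^+ 2 / alpha) g gt.
Let tau := 24 * L ^+ 2 / alpha.
Let eta := alpha / (24 * L ^+ 2).

Let tau_gt0 : 0 < tau.
Proof. by rewrite divr_gt0// mulr_gt0// exprn_gt0. Qed.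
Let eta_gt0 : 0 < eta.
Proof. by rewrite divr_gt0// mulr_gt0// exprn_gt0. Qed.
Let eta_tau : eta * tau = 1.
Proof. by rewrite /eta /tau; field; rewrite !gt_eqF. Qed.

(** The estimator is only measurable on [domain]; it is extended by [0]. *)
Definition total_estimator (p : zspace R n m * S) : zspace R n m :=
  if `[< domain p.1 >] then gt p.1 p.2 else 0.

Lemma total_estimatorE w s : domain w -> total_estimator (w, s) = gt w s.
Proof. by move=> dw; rewrite /total_estimator asboolT. Qed.

Lemma measurable_total_estimator : measurable_fun setT total_estimator.
Proof.
have e : (fun p : zspace R n m * S => `[< domain p.1 >]) @^-1` [set true]
    = domain `*` [set: S].
  by apply/seteqP; split=> p /=; [move/asboolP|move=> [dp _]; exact/asboolP].
apply: measurable_fun_if => //.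
- apply: (measurable_fun_bool true); rewrite setTI e.
  by apply: measurableX => //; exact: measurable_domain.
- by rewrite setTI e; case: gt_cbb.
Qed.

Lemma estimator_moments w : domain w ->
  bounded_moments mu (fun s => total_estimator (w, s) - g w0) tau
    (L ^+ 2 * znorm (w - w0) ^+ 2).
Proof.
move=> dw; have [_ /(_ w dw)[_ _ ae mom]] := gt_cbb.
have mG : measurable_fun setT (fun s => total_estimator (w, s) - g w0).
  apply: measurable_zB; last exact: measurable_cst.
  exact: (measurableT_comp measurable_total_estimator (pair1_measurable w)).
have [/measurable_fun_pairP[mG1 _] [_ mG2]] := (mG, (measurable_zP _).1 mG).
pose E1 := (\int[mu]_s (l2norm (total_estimator (w, s) - g w0).1 ^+ 2)%:E)%E.
pose E2 i := (\int[mu]_s ((total_estimator (w, s) - g w0).2 i 0 ^+ 2)%:E)%E.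
have E1_ge0 : (0 <= E1)%E by apply: integral_ge0 => s _; rewrite lee_fin sqr_ge0.
have E2_ge0 i : (0 <= E2 i)%E by apply: integral_ge0 => s _; rewrite lee_fin sqr_ge0.
have le_mom i : (E1 + E2 i <= (L ^+ 2 * znorm (w - w0) ^+ 2)%:E)%E.
  apply: le_trans mom; apply: leeD.
    rewrite le_eqVlt; apply/orP; left; apply/eqP; rewrite unlock.
    by apply: eq_integral => s _; rewrite total_estimatorE.
  rewrite (bigD1 i)//= le_max; apply/orP; left.
  rewrite le_eqVlt; apply/orP; left; apply/eqP; rewrite unlock.
  by apply: eq_integral => s _; rewrite total_estimatorE.
(* The simplex is empty for [m = 0], so an index exists; through it the joint bound makes the mean
   of the first block finite. *)
have [i0 _] := simplex_inhabited (domain_simplex w0_domain).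
have E1_lty : (E1 < +oo)%E.
  by apply: (@le_lt_trans _ _ (E1 + E2 i0)%E);
    [rewrite leeDl|apply: le_lt_trans (le_mom i0) _; rewrite ltry].
have E2_lty i : (E2 i < +oo)%E.
  by apply: (@le_lt_trans _ _ (E1 + E2 i)%E);
    [rewrite leeDr|apply: le_lt_trans (le_mom i) _; rewrite ltry].
have s1 : summable_rv mu (fun s => l2norm (total_estimator (w, s) - g w0).1 ^+ 2).
  apply/integrableP; split.
    by apply/measurable_EFinP; apply: measurable_funX; exact: measurable_l2norm.
  by under eq_integral do rewrite /= ger0_norm ?sqr_ge0//; exact: E1_lty.
have s2 i : summable_rv mu (fun s => (total_estimator (w, s) - g w0).2 i 0 ^+ 2).
  apply/integrableP; split.
    by apply/measurable_EFinP; apply: measurable_funX.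
  by under eq_integral do rewrite /= ger0_norm ?sqr_ge0//; exact: E2_lty.
split=> //.
- move=> i; apply: filterS ae => s h; rewrite total_estimatorE//.
  by apply: le_trans h; exact: (linfnorm_coord (gt w s - g w0).2).
- by move=> i; rewrite -lee_fin EFinD -!meanE//; exact: le_mom.
Qed.

(** The mean is taken of the difference from [g w0], whose moments are controlled; on [domain] the
    result is the plain mean ([mean_estimatorE]). *)
Definition mean_estimator w : zspace R n m :=
  g w0 + mean_vec mu (fun s => total_estimator (w, s) - g w0).

Lemma measurable_mean_estimator : measurable_fun setT mean_estimator.
Proof.
apply: measurable_zD => //.
have [G1 G2] := (measurable_zP _).1 measurable_total_estimator.
apply/measurable_zP; split=> i.
- under eq_fun do rewrite mxE.
  apply: (@measurable_mean _ _ _ mu _ _ (fun p : zspace R n m * S => (total_estimator p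
    - g w0).1 i 0)).
  by under eq_fun do rewrite !mxE; apply: measurable_funB.
- under eq_fun do rewrite mxE.
  apply: (@measurable_mean _ _ _ mu _ _ (fun p : zspace R n m * S => (total_estimator p
    - g w0).2 i 0)).
  by under eq_fun do rewrite !mxE; apply: measurable_funB.
Qed.

Lemma mean_estimatorE w : domain w ->
  mean_estimator w = (expected_cV mu (fun s => (gt w s).1),
                      expected_cV mu (fun s => (gt w s).2)).
Proof.
move=> dw; have bm := estimator_moments dw.
have [m1 m2] := (measurable_zP _).1 (bm_measurable bm).
have mean_shift (f : S -> R) c : measurable_fun setT (fun s => f s - c) ->
    summable_rv mu (fun s => (f s - c) ^+ 2) -> c + mean mu (fun s => f s - c)
        = fine 'E_mu[f].
  move=> mf sf; have [sfc _ _ _] := variance_le mf sf.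
  have := meanD (summable_rv_cst mu c) sfc; rewrite mean_cst => <-.
  rewrite unlock; congr fine; apply: eq_integral => s _.
  by rewrite /cst subrKC.
rewrite [LHS]surjective_pairing; congr (_, _); apply/matrixP => i j;
  rewrite (ord1 j) !mxE.
- under [X in _ + mean _ X]eq_fun do rewrite total_estimatorE// !mxE.
  apply: mean_shift.
    by have := m1 i; under eq_fun do rewrite total_estimatorE// !mxE.
  have := bm_summable1 bm; under eq_fun do rewrite total_estimatorE//; move=> s1.
  apply: summable_rv_le s1 _.
    by apply: measurable_funX; have := m1 i; under eq_fun do rewrite total_estimatorE//
      !mxE.
  move=> s; rewrite ger0_norm ?sqr_ge0// l2norm_sqr (bigD1 i)//= !mxE lerDl.
  by apply: sumr_ge0 => k _; exact: sqr_ge0.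
- under [X in _ + mean _ X]eq_fun do rewrite total_estimatorE// !mxE.
  apply: mean_shift.
    by have := m2 i; under eq_fun do rewrite total_estimatorE// !mxE.
  by have := bm_summable2 bm i; under eq_fun do rewrite total_estimatorE// !mxE.
Qed.

(** Only the second block is biased. The factor 2 is its l1 diameter, and [1 / tau = eta] supplies
    the second [eta]. *)
Lemma mean_estimator_bias w u : domain w -> domain u ->
  eta * pairing (g w - mean_estimator w) (w - u)
  <= 2 * eta ^+ 2 * (L ^+ 2 * znorm (w - w0) ^+ 2).
Proof.
move=> dw du; have [_ /(_ w dw)[e1 le2 _ _]] := gt_cbb.
rewrite -(opprB (mean_estimator w)) pairingNl -pairingNr opprB.
rewrite mean_estimatorE// /pairing /= e1 subrr.
rewrite [X in X + _]big1 ?add0r => [|i _]; last by rewrite mxE mul0r.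
have h1 := dot_holder (expected_cV mu (fun s => (gt w s).2) - (g w).2) (u - w).2.
have h2 := simplex_l1diam (domain_simplex du) (domain_simplex dw).
have h3 : linfnorm (expected_cV mu (fun s => (gt w s).2) - (g w).2) * l1norm (u - w).2
    <= L ^+ 2 / tau * znorm (w - w0) ^+ 2 * 2.
  by apply: ler_pM => //; [exact: normr_ge0|exact: l1norm_ge0].
have tauV : tau^-1 = eta by rewrite -[LHS]mul1r -eta_tau mulfK// gt_eqF.
rewrite tauV in h3.
have := ler_wpM2l (ltW eta_gt0) (le_trans h1 h3); rewrite /=; lra.
Qed.

Lemma second_order_gap_ge0 (p gam : zspace R n m) : domain p -> 0
    <= second_order_gap p gam.
Proof.
move=> [_ /simplexP[p0 _]]; apply: addr_ge0; first by rewrite mulr_ge0 ?sqr_ge0.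
apply: sumr_ge0 => i _; rewrite mulr_ge0//.
by have := expR_ge1Dx (- gam.2 i 0); lra.
Qed.

(** The stochastic part of the one-step regret, minus the bound on its mean. *)
Definition step_noise (p : (zspace R n m * zspace R n m) * S) : R :=
  let est := total_estimator (p.1.1, p.2) in
  let zeta := eta *: (mean_estimator p.1.1 - est) in
  second_order_gap p.1.1 (eta *: (est - g w0))
  + second_order_gap p.1.2 zeta + pairing zeta (p.1.1 - p.1.2)
  - 3 * eta ^+ 2 * (L ^+ 2 * znorm (p.1.1 - w0) ^+ 2).

Lemma measurable_step_noise : measurable_fun setT step_noise.
Proof.
have mw : measurable_fun setT (fun p : (zspace R n m * zspace R n m) * S => p.1.1).
  exact: (measurableT_comp measurable_fst measurable_fst).
have ms : measurable_fun setT (fun p : (zspace R n m * zspace R n m) * S => p.1.2).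
  exact: (measurableT_comp measurable_snd measurable_fst).
have mest : measurable_fun setT (fun p : (zspace R n m * zspace R n m) * S =>
    total_estimator (p.1.1, p.2)).
  apply: (measurableT_comp measurable_total_estimator).
  exact: measurable_fun_pair.
have mgb := measurableT_comp measurable_mean_estimator mw.
have mz : measurable_fun setT (fun p : (zspace R n m * zspace R n m) * S =>
    eta *: (mean_estimator p.1.1 - total_estimator (p.1.1, p.2))).
  by apply: measurable_zZ; exact: measurable_zB.
apply: measurable_funB; last first.
  by do 2 apply: measurable_funM => //; apply: measurable_znorm_sqr;
    exact: measurable_zB.
apply: measurable_funD; last by apply: measurable_pairing => //; exact: measurable_zB.
apply: measurable_funD; apply: measurable_second_order_gap => //.
by apply: measurable_zZ; exact: measurable_zB.
Qed.

(** A loose bound; what matters is that it does not depend on the state. The 8 and the 4 bound the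
    squared diameters of the domain and of the ball. *)
Definition step_noise_bound : R :=
  9 * eta ^+ 2 * (L ^+ 2 * 8) + eta ^+ 2 * (L ^+ 2 * 8) * m.+1%:R + 4 + m%:R.

Lemma norm_noise_le (a b p c : R) : 0 <= a -> 0 <= b -> 0 <= c ->
  `|a + b + p - c| <= a + b + `|p| + c.
Proof.
move=> a0 b0 c0; rewrite ler_norml.
by have := ler_norm p; have := ler_norm (- p); rewrite normrN => ? ?; apply/andP;
  split; lra.
Qed.

(** The two gaps have mean at most [3/2 eta^2 L^2 znorm (w - w0)^2] each, which the subtracted term
    compensates; the pairing has mean 0 because [w] and [s] are fixed here. *)
Lemma step_noise_mean w s : domain w -> domain s ->
  [/\ summable_rv mu (fun x => step_noise ((w, s), x)),
      mean mu (fun x => step_noise ((w, s), x)) <= 0,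
      summable_rv mu (fun x => `|step_noise ((w, s), x)|)
    & mean mu (fun x => `|step_noise ((w, s), x)|) <= step_noise_bound].
Proof.
move=> dw ds; have bm := estimator_moments dw.
have [i0 _] := simplex_inhabited (domain_simplex w0_domain).
set N := L ^+ 2 * _ in bm; have N0 : 0 <= N by rewrite mulr_ge0 ?sqr_ge0.
have N8 : N <= L ^+ 2 * 8 by rewrite ler_wpM2l ?sqr_ge0// domain_diam.
pose D x := total_estimator (w, x) - g w0.
have ee x : mean_estimator w - total_estimator (w, x) = mean_vec mu D - D x.
  by rewrite /mean_estimator /D opprB addrCA addrA.
have cm := centered_moments (ltW tau_gt0) bm.
(* Since [eta tau = 1], the scaled difference is bounded by 1 and its centered version by 2, within
   the range of [expR_le_quadratic]. *)
have bm1 : bounded_moments mu (fun x => eta *: D x) 2 (eta ^+ 2 * N).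
  apply: bounded_momentsW (bounded_momentsZ eta bm).
  by rewrite gtr0_norm// eta_tau; lra.
have bm2 : bounded_moments mu (fun x => eta *: (mean_vec mu D - D x)) 2 (eta ^+ 2 * N).
  apply: bounded_momentsW (bounded_momentsZ eta cm).
  by rewrite gtr0_norm// mulrCA eta_tau; lra.
have [g1 g1'] := bounded_moments_gap bm1 (domain_simplex dw).
have [g2 g2'] := bounded_moments_gap bm2 (domain_simplex ds).
have [p1 p1'] := mean_abs_pairing (w - s) i0 bm2.
have [p0 p0'] := mean_pairing_centered bm (w - s).
have eN x : step_noise ((w, s), x) = second_order_gap w (eta *: D x)
    + second_order_gap s (eta *: (mean_vec mu D - D x))
    + eta * pairing (mean_vec mu D - D x) (w - s) - 3 * eta ^+ 2 * N.
  by rewrite /step_noise /= ee pairingZl.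
have sp := summable_rvZ eta p0; have s12 := summable_rvD g1 g2.
have sc := summable_rv_cst mu (3 * eta ^+ 2 * N).
have s3 := summable_rvD s12 sp.
have sa := summable_rvD (summable_rvD s12 p1) sc.
have mb := measurableT_comp measurable_step_noise (pair1_measurable (w, s)).
have le_a x : `|step_noise ((w, s), x)| <= second_order_gap w (eta *: D x)
    + second_order_gap s (eta *: (mean_vec mu D - D x))
    + `|pairing (eta *: (mean_vec mu D - D x)) (w - s)| + cst (3 * eta ^+ 2 * N) x.
  rewrite eN pairingZl; apply: norm_noise_le.
  - exact: second_order_gap_ge0.
  - exact: second_order_gap_ge0.
  - by apply: mulr_ge0 => //; apply: mulr_ge0 => //; exact: sqr_ge0.
have sn : summable_rv mu (fun x => `|step_noise ((w, s), x)|).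
  apply: summable_rv_le sa _; first exact: measurableT_comp.
  by move=> x; rewrite normr_id; exact: le_a.
split=> //.
- by under eq_fun do rewrite eN; exact: (summable_rvB s3 sc).
- under [X in mean _ X]eq_fun do rewrite eN.
  have := meanB s3 sc; rewrite mean_cst (meanD s12 sp) (meanD g1 g2) (meanZ eta p0) p0'
      mulr0 => ->.
  by rewrite addr0 subr_le0; apply: (le_trans (lerD g1' g2')); lra.
apply: (le_trans (le_mean sn sa le_a)).
rewrite (meanD (summable_rvD s12 p1) sc) mean_cst (meanD s12 p1) (meanD g1 g2).
have := l2ball_diam dw.1 ds.1; have := domain_sumsq2 dw ds.
move=> h1 h2; rewrite /step_noise_bound.
have e2 : 0 <= eta ^+ 2 by exact: sqr_ge0.
have h3 := ler_wpM2l e2 N8.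
have h4 : eta ^+ 2 * N * m.+1%:R <= eta ^+ 2 * (L ^+ 2 * 8) * m.+1%:R by rewrite
    ler_wpM2r.
move: p1' g1' g2'; rewrite /= => p1' g1' g2'.
have h5 : 0 <= eta ^+ 2 * (L ^+ 2 * 8).
  by apply: mulr_ge0; [exact: sqr_ge0|rewrite mulr_ge0 ?sqr_ge0].
lra.
Qed.
End estimator.

(** * The joint chain of iterates and ghost iterates *)

Section ghost_iterates.
Context {R : realType} {n m : nat}.
Variables (alpha L : R) (alpha_gt0 : 0 < alpha) (L_gt0 : 0 < L).
Variables (w0 : zspace R n m) (w0_domain : domain w0).
Variable g : zspace R n m -> zspace R n m.
Context {d : measure_display} {S : measurableType d}.
Variables (mu : probability S R) (gt : zspace R n m -> S -> zspace R n m).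
Hypothesis gt_cbb : centered_bounded_biased mu w0 L (24 * L ^+ 2 / alpha) g gt.
Let eta := alpha / (24 * L ^+ 2).
Let eta_gt0 : 0 < eta.
Proof. by rewrite divr_gt0// mulr_gt0// exprn_gt0. Qed.
Let eta_alpha : eta * alpha = 24 * (eta ^+ 2 * L ^+ 2).
Proof. by rewrite /eta; field; rewrite gt_eqF. Qed.

(** The first component is the iterate; the second one is a ghost iterate,
    driven by the centered noise of the estimator. *)
Definition step (p : (zspace R n m * zspace R n m) * S) : zspace R n m * zspace R n m :=
  let est := total_estimator gt (p.1.1, p.2) in
  (prox (alpha / 2) eta^-1 w0 p.1.1 est,
   prox 0 1 w0 p.1.2 (eta *: (mean_estimator w0 g mu gt p.1.1 - est))).

(** Joining the two sequences gives a single chain driven by the seeds, as the independence results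
    require. *)
Fixpoint state (s : nat -> S) (t : nat) : zspace R n m * zspace R n m :=
  if t is t'.+1 then step (state s t', s t') else (w0, w0).

Lemma measurable_step : measurable_fun setT step.
Proof.
have mw : measurable_fun setT (fun p : (zspace R n m * zspace R n m) * S => p.1.1).
  exact: (measurableT_comp measurable_fst measurable_fst).
have ms : measurable_fun setT (fun p : (zspace R n m * zspace R n m) * S => p.1.2).
  exact: (measurableT_comp measurable_snd measurable_fst).
have mest : measurable_fun setT (fun p : (zspace R n m * zspace R n m) * S =>
    total_estimator gt (p.1.1, p.2)).
  apply: (measurableT_comp (measurable_total_estimator gt_cbb)).
  exact: measurable_fun_pair.
have mgb := measurableT_comp (measurable_mean_estimator gt_cbb) mw.
apply: measurable_fun_pair; apply: measurable_prox => //.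
by apply: measurable_zZ; exact: measurable_zB.
Qed.

Lemma state_domain s t : domain (state s t).1 /\ same_support w0 (state s t).1.
Proof. by case: t => [|t] //=; exact: prox_domain. Qed.

Lemma ghost_state_domain s t : domain (state s t).2.
Proof. by case: t => [|t] //=; exact: (proj1 (prox_domain _ _ _ _ w0_domain)). Qed.

Lemma state_iterate s t : (state s t).1 = iterate gt alpha eta w0 s t.
Proof.
elim: t => [//|t IH] /=; rewrite -IH; have [dw sw] := state_domain s t.
by rewrite total_estimatorE// prox_stepE// ltW.
Qed.

Lemma znormN (z : zspace R n m) : znorm (- z) = znorm z.
Proof.
rewrite /znorm !l2norm_sqr /l1norm; congr (Num.sqrt (_ + _ ^+ 2));
  by apply: eq_bigr => i _; rewrite mxE ?sqrrN ?normrN.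
Qed.

Lemma mean_estimator_gap w : domain w ->
  second_order_gap w (eta *: (mean_estimator w0 g mu gt w - g w0))
  <= 3 / 2 * (eta ^+ 2 * (L ^+ 2 * znorm (w - w0) ^+ 2)).
Proof.
move=> dw; have bm := estimator_moments w0_domain gt_cbb dw.
set N := L ^+ 2 * _ in bm *.
rewrite /mean_estimator [X in eta *: X]addrAC subrr add0r.
set e := mean_vec _ _.
have tau0 : 0 <= 24 * L ^+ 2 / alpha by rewrite divr_ge0 ?(ltW alpha_gt0)// mulr_ge0
    ?sqr_ge0.
have et : eta * (24 * L ^+ 2 / alpha) = 1 by rewrite /eta; field; rewrite !gt_eqF.
(* The deterministic mean is viewed as a constant random vector, so that the moment bound on the gap
   applies to it. *)
have bc : bounded_moments mu (cst e) (24 * L ^+ 2 / alpha) N.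
  split=> [||i|i|i].
  - exact: measurable_cst.
  - exact: (summable_rv_cst mu (l2norm e.1 ^+ 2)).
  - exact: (summable_rv_cst mu (e.2 i 0 ^+ 2)).
  - by apply: aeW => s; exact: mean_vec_bounded bm i.
  - rewrite (mean_cst mu (l2norm e.1 ^+ 2)) (mean_cst mu (e.2 i 0 ^+ 2)).
    exact: mean_vec_moments bm i.
have bc2 : bounded_moments mu (fun s => eta *: cst e s) 2 (eta ^+ 2 * N).
  apply: bounded_momentsW (bounded_momentsZ eta bc).
  by rewrite gtr0_norm// et; lra.
have [_] := bounded_moments_gap bc2 (domain_simplex dw).
by rewrite (mean_cst mu (second_order_gap w (eta *: e))).
Qed.

Lemma regret_step_noise s T u : 4 <= eta * alpha * T%:R ->
  domain u -> dominated w0 u ->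
  eta * \sum_(1 <= t < T.+1) pairing (g (state s t).1) ((state s t).1 - u)
  - eta * alpha * T%:R * rbregman w0 u
  <= \sum_(t < T) step_noise alpha L w0 g mu gt (state s t, s t).
Proof.
move=> T4 du wu /=; pose w t := (state s t).1.
have dw t : domain (w t) := (state_domain s t).1.
have sw t : same_support w0 (w t) := (state_domain s t).2.
pose N t := L ^+ 2 * znorm (w t - w0) ^+ 2.
have := @regret _ _ _ alpha eta w0 (ltW alpha_gt0) eta_gt0 w0_domain g w
  (fun t => (state s t).2) (fun t => total_estimator gt (w t, s t))
  (fun t => mean_estimator w0 g mu gt (w t)) erefl erefl (fun=> erefl) (fun=> erefl) T
    u du wu.
have V0 := rbregman_ge0 w0_domain du wu.
have h1 : (2 - eta * alpha * T%:R / 2) * rbregman w0 u <= 0.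
  by rewrite mulr_le0_ge0//; lra.
have h2 := mean_estimator_gap (dw T).
have h3 : \sum_(t < T.+1) eta * pairing (g (w t)
    - mean_estimator w0 g mu gt (w t)) (w t - u)
    <= \sum_(t < T.+1) 2 * eta ^+ 2 * N t.
  by apply: ler_sum => t _; exact: mean_estimator_bias.
have N0 t : 0 <= eta ^+ 2 * N t.
  by rewrite mulr_ge0 ?sqr_ge0// mulr_ge0 ?sqr_ge0.
(* The 5 is the bias 2 plus the 3 subtracted in [step_noise]; at index [T] a single gap of 3/2
   stands in for the latter. *)
have h4 : \sum_(t < T.+1) 5 * (eta ^+ 2 * N t)
    <= eta * alpha / 2 * \sum_(t < T.+1) rbregman w0 (w t).
  rewrite mulr_sumr; apply: ler_sum => t _.
  have wd : dominated w0 (w t) by move=> i /eqP; rewrite (sw t) => /eqP.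
  have := pinsker w0_domain (dw t) wd; rewrite -znormN opprB => pk.
  have e0 : 0 <= eta ^+ 2 * L ^+ 2 by rewrite mulr_ge0 ?sqr_ge0.
  have vt := rbregman_ge0 w0_domain (dw t) wd.
  have := ler_wpM2l e0 pk; have := mulr_ge0 e0 vt.
  by rewrite eta_alpha /N; nra.
move: h4; rewrite big_ord_recr/= -mulr_sumr => h4.
have h5 : \sum_(t < T.+1) 2 * eta ^+ 2 * N t = 2 * (\sum_(t < T) eta ^+ 2 * N t
    + eta ^+ 2 * N T).
  rewrite big_ord_recr/= mulrDr mulr_sumr mulrA; congr (_ + _).
  by apply: eq_bigr => t _; rewrite mulrA.
have -> : \sum_(t < T) step_noise alpha L w0 g mu gt (state s t, s t) =
   \sum_(t < T) (second_order_gap (w t) (eta *: (total_estimator gt (w t, s t) - g w0))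
        + second_order_gap (state s t).2 (eta *: (mean_estimator w0 g mu gt (w t)
          - total_estimator gt (w t, s t)))
        + pairing (eta *: (mean_estimator w0 g mu gt (w t) - total_estimator gt (w t,
          s t))) (w t - (state s t).2))
   - 3 * \sum_(t < T) eta ^+ 2 * N t.
  by rewrite mulr_sumr -sumrB; apply: eq_bigr => t _; rewrite /step_noise/=;
    congr (_ - _); rewrite -mulrA.
rewrite h5 in h3; have := N0 T; rewrite -/(N T) in h2.
move: h2; set G := \sum_(t < T) _; lra.
Qed.
End ghost_iterates.

(** * Measurability and boundedness of the operator on the domain *)

Section lipschitz_operator.
Context {R : realType} {n m : nat}.
Variables (L : R) (g : zspace R n m -> zspace R n m).
Hypotheses (L_gt0 : 0 < L) (g_lip : lipschitz_op L g).

Lemma dualnorm_coord (gam : zspace R n m) :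
  (forall i, `|gam.1 i 0| <= dualnorm gam) /\ (forall i, `|gam.2 i 0| <= dualnorm gam).
Proof.
split=> i; rewrite -sqrtr_sqr ler_wsqrtr//.
  rewrite l2norm_sqr (bigD1 i)//= -addrA lerDl addr_ge0 ?sqr_ge0//.
  by apply: sumr_ge0 => j _; exact: sqr_ge0.
rewrite -real_normK ?num_real//; apply: ler_wpDl; first exact: sqr_ge0.
by rewrite ler_pXn2r ?nnegrE// ?linfnorm_coord// /linfnorm.
Qed.

Lemma measurable_lipschitz_op d (T : measurableType d) (f : T -> zspace R n m) :
  measurable_fun setT f -> (forall t, domain (f t)) ->
  measurable_fun setT (fun t => g (f t)).
Proof.
move=> mf df.
have mgf (h : zspace R n m -> R) : measurable_fun domain h -> measurable_fun setT (h \o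
    f).
  move=> mh; apply: (measurable_comp (@measurable_domain R n m) _ mh mf).
  by move=> _ [t _ <-]; exact: df.
apply/measurable_zP; split=> i.
- apply: (mgf (fun z => (g z).1 i 0)).
  apply: (measurable_lipschitz (@measurable_domain R n m) (ltW L_gt0)) => z z' dz dz'.
  apply: le_trans (g_lip dz dz').
  by have := (dualnorm_coord (g z - g z')).1 i; rewrite !mxE.
- apply: (mgf (fun z => (g z).2 i 0)).
  apply: (measurable_lipschitz (@measurable_domain R n m) (ltW L_gt0)) => z z' dz dz'.
  apply: le_trans (g_lip dz dz').
  by have := (dualnorm_coord (g z - g z')).2 i; rewrite !mxE.
Qed.

Lemma pairing_lipschitz_bounded (w0 : zspace R n m) : domain w0 ->
  exists C, forall w u u', domain w -> domain u -> domain u' ->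
    `|pairing (g w) (u - u')| <= C.
Proof.
move=> dw0.
pose C := \sum_i (L * 3 + `|(g w0).1 i 0|) * 2 + \sum_i (L * 3 + `|(g w0).2 i 0|) * 2.
exists C => w u u' dw du du'.
(* The squared diameter is at most 8, rounded up to [3^2] to avoid a square root. *)
have lip : dualnorm (g w - g w0) <= L * 3.
  apply: le_trans (g_lip dw dw0) _; rewrite ler_wpM2l ?(ltW L_gt0)//.
  rewrite -(@ler_pXn2r _ 2)// ?nnegrE ?sqrtr_ge0//.
  by apply: le_trans (domain_diam dw dw0) _; lra.
have [b1 b2] := dualnorm_coord (g w - g w0).
apply: (le_trans (ler_normD _ _)); apply: lerD; apply: (le_trans (ler_norm_sum _ _ _));
  apply: ler_sum => i _; rewrite normrM; apply: ler_pM => //.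
- have := le_trans (b1 i) lip; rewrite !mxE => h.
  rewrite -(subrK ((g w0).1 i 0) ((g w).1 i 0)).
  by apply: (le_trans (ler_normD _ _)); rewrite lerD2r.
- have := l2ball_diam du.1 du'.1; rewrite l2norm_sqr (bigD1 i)//= => h.
  rewrite -(@ler_pXn2r _ 2)// ?nnegrE// real_normK ?num_real//.
  have : 0 <= \sum_(j < n | j != i) (u.1 - u'.1) j 0 ^+ 2.
    by apply: sumr_ge0 => j _; exact: sqr_ge0.
  by move: h; rewrite !mxE; lra.
- have := le_trans (b2 i) lip; rewrite !mxE => h.
  rewrite -(subrK ((g w0).2 i 0) ((g w).2 i 0)).
  by apply: (le_trans (ler_normD _ _)); rewrite lerD2r.
- rewrite !mxE ler_norml.
  have /andP[? ?] := simplex_coord_le1 i du.2; have /andP[? ?]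
      := simplex_coord_le1 i du'.2.
  by apply/andP; split; lra.
Qed.
End lipschitz_operator.

(** * Random maxima and averages of points of the domain *)

(** The maximizer of an affine function minus [alpha V] is a proximal step from [w0], explicit in
    the slope, so the maximum is measurable. The bound by [Y] holds for all [u] at once, hence at
    this random maximizer. *)
Lemma expected_max_le_linear (R : realType) (n m : nat) (alpha kappa C : R)
    (w0 : zspace R n m) (dO : measure_display) (Omega : measurableType dO)
    (P : probability Omega R) (c : Omega -> R) (G : Omega -> zspace R n m)
    (Y : Omega -> R) :
  0 < alpha -> 0 < kappa -> domain w0 ->
  measurable_fun setT c -> measurable_fun setT G ->
  (forall o u, domain u -> `|c o - pairing (G o) u| <= C) ->
  summable_rv P Y -> mean P Y <= 0 ->
  (forall o u, domain u -> dominated w0 u ->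
     kappa * (c o - pairing (G o) u - alpha * rbregman w0 u) <= Y o) ->
  expected_max_le P (fun o u =>
    ((c o - pairing (G o) u)%:E - alpha%:E * bregman w0 u)%E) 0.
Proof.
move=> alpha0 kappa0 dw0 mc mG bC sY Y0 le_Y.
pose us o := prox 0 alpha w0 w0 (G o).
have dus o : domain (us o) /\ same_support w0 (us o) := prox_domain _ _ _ _ dw0.
have wus o : dominated w0 (us o) by move=> i /eqP; rewrite (dus o).2 => /eqP.
pose M o := c o - pairing (G o) (us o) - alpha * rbregman w0 (us o).
have le_M o u : domain u -> dominated w0 u ->
    c o - pairing (G o) u - alpha * rbregman w0 u <= M o.
  move=> du wu; have a1 : 0 < 0 + alpha by rewrite add0r.
  have := prox_optimal (G o) (lexx 0) (ltW alpha0) a1 dw0 dw0 (fun=> erefl) du wu.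
  rewrite /= -/(us o) mul0r addr0 pairingBr /M.
  have : 0 <= alpha * rbregman (us o) u.
    apply: mulr_ge0; first exact: ltW.
    by apply: (rbregman_ge0 (dus o).1 du (same_support_dominated (dus o).2 wu)).
  lra.
have FM o u : dominated w0 u -> ((c o - pairing (G o) u)%:E - alpha%:E * bregman w0 u
    = (c o - pairing (G o) u - alpha * rbregman w0 u)%:E)%E.
  by move=> wu; rewrite bregman_dominated.
have mus : measurable_fun setT us by exact: measurable_prox.
have mM : measurable_fun setT M.
  apply: measurable_funB; last by apply: measurable_funM => //;
    exact: measurable_rbregman.
  by apply: measurable_funB => //; exact: measurable_pairing.
have sM : summable_rv P M.
  (* [M] is at least the value at [u = w0], where the divergence vanishes, and at most [C] because
     the divergence is nonnegative. *)
  apply: summable_rv_le mM (summable_rv_cst P C) _ => o /=.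
  have := le_M o w0 dw0 (fun i => id); rewrite rbregman_refl mulr0 subr0.
  have := bC o w0 dw0; have := bC o (us o) (dus o).1.
  have : 0 <= alpha * rbregman w0 (us o).
    by rewrite mulr_ge0 ?(ltW alpha0)// rbregman_ge0//; exact: (dus o).1.
  rewrite !ler_norml => v0 /andP[a1 a2] /andP[b1 b2] h.
  by rewrite /M in h *; apply/andP; split; lra.
exists M; split=> //.
- move=> o; split; first by exists (us o); [exact: (dus o).1|rewrite FM].
  move=> u du; have [wu|wu] := pselect (dominated w0 u).
    by rewrite FM// lee_fin; exact: le_M.
  by rewrite bregman_pinfty// gt0_muley ?lte_fin// leNye.
- rewrite unlock meanE// lee_fin -(pmulr_rle0 _ kappa0) -meanZ//.
  apply: le_trans Y0; apply: le_mean => //; first exact: summable_rvZ.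
  by move=> o; apply: le_Y; [exact: (dus o).1|exact: wus].
Qed.

Lemma domain_average (R : realType) (n m T : nat) (w : nat -> zspace R n m) :
  (0 < T)%N -> (forall t, domain (w t)) ->
  domain (T%:R^-1 *: \sum_(1 <= t < T.+1) w t).
Proof.
move=> T0 dw; have TR : 0 < T%:R :> R by rewrite ltr0n.
rewrite big_add1/= big_mkord.
have sum1 : (\sum_(t < T) w t.+1).1 = \sum_(t < T) (w t.+1).1 by elim/big_rec2: _ => //
    t _ y _ <-.
have sum2 : (\sum_(t < T) w t.+1).2 = \sum_(t < T) (w t.+1).2 by elim/big_rec2: _ => //
    t _ y _ <-.
have T1 : \sum_(t < T) T%:R^-1 = 1 :> R.
  by rewrite sumr_const card_ord -[LHS]mulr_natr mulVf// gt_eqF.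
split.
- apply/l2ballP; set x := (_ *: _).1.
  have xE i : x i 0 = \sum_(t < T) T%:R^-1 * (w t.+1).1 i 0.
    by rewrite /x /= sum1 mxE summxE mulr_sumr.
  (* [|x|^2] is the average of [x . w_t], each at most [(|x|^2 + 1) / 2]; this forces
     [|x|^2 <= 1]. *)
  have : \sum_i x i 0 ^+ 2 <= \sum_(t < T) T%:R^-1 * ((\sum_i x i 0 ^+ 2 + 1) / 2).
    have xx : \sum_i x i 0 ^+ 2 = \sum_(t < T) T%:R^-1 * \sum_i x i 0 * (w t.+1).1 i 0.
      under [RHS]eq_bigr do rewrite mulr_sumr.
      rewrite exchange_big/=; apply: eq_bigr => i _.
      by rewrite expr2 {2}xE mulr_sumr; apply: eq_bigr => t _; rewrite mulrCA.
    rewrite [leLHS]xx; apply: ler_sum => t _; rewrite ler_pM2l ?invr_gt0//.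
    have /l2ballP wt := (dw t.+1).1.
    rewrite ler_pdivlMr// mulr_suml.
    apply: (@le_trans _ _ (\sum_i x i 0 ^+ 2 + \sum_i (w t.+1).1 i 0 ^+ 2));
      last by rewrite lerD2l.
    rewrite -big_split; apply: ler_sum => i _ /=.
    by have := sqr_ge0 (x i 0 - (w t.+1).1 i 0); lra.
  rewrite -mulr_suml T1; lra.
- apply/simplexP; rewrite /= sum2; split=> [i|].
    rewrite mxE summxE; apply: mulr_ge0; first by rewrite invr_ge0 ltW.
    apply: sumr_ge0 => t _.
    by have /simplexP[+ _] := (dw t.+1).2; exact.
  under eq_bigr do rewrite mxE summxE.
  rewrite -mulr_sumr exchange_big/=.
  rewrite (eq_bigr (fun=> 1)); last by move=> t _; have /simplexP[] := (dw t.+1).2.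
  by rewrite sumr_const card_ord mulVf// gt_eqF.
Qed.

(** * Expected regret of the iterates and the averaged output *)

Section iterates.
Variables (R : realType) (n m : nat)
    (alpha L : R) (alpha_gt0 : 0 < alpha) (L_gt0 : 0 < L)
    (w0 : zspace R n m) (w0_domain : domain w0)
    (g : zspace R n m -> zspace R n m)
    (g_lipschitz : lipschitz_op L g)
    (d : measure_display) (S : measurableType d) (mu : probability S R)
    (gt : zspace R n m -> S -> zspace R n m)
    (gt_cbb : centered_bounded_biased mu w0 L (24 * L ^+ 2 / alpha) g gt).
Let eta := alpha / (24 * L ^+ 2).
Variables
    (T : nat) (T_large : 4 / (eta * alpha) <= T%:R)
    (d' : measure_display) (Omega : measurableType d')
    (P : probability Omega R)
    (xi : nat -> {RV P >-> S}) (xi_iid : iid_seeds mu T xi).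
Let w t o := iterate gt alpha eta w0 (fun k => xi k o) t.
Let st t o := state alpha L w0 g mu gt (fun k => xi k o) t.
Let eta_gt0 : 0 < eta.
Proof. by rewrite divr_gt0// mulr_gt0// exprn_gt0. Qed.
Let T_gt0 : 0 < T%:R :> R.
Proof. by apply: lt_le_trans T_large; rewrite divr_gt0// mulr_gt0. Qed.

Let wE t o : w t o = (st t o).1.
Proof. by rewrite /w /st (state_iterate alpha_gt0 L_gt0 w0_domain). Qed.

Lemma measurable_state t : measurable_fun setT (st t).
Proof.
exact: (@measurable_chain _ _ _ _ _ _ _ _ xi _ st (w0,
  w0) (measurable_step gt_cbb) erefl (fun _ _ => erefl)).
Qed.

Lemma measurable_iterate t : measurable_fun setT (w t).
Proof.
rewrite (_ : w t = fst \o st t); last by apply/funext => o; rewrite wE.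
exact: measurableT_comp (measurable_state t).
Qed.

Lemma iterate_domain t o : domain (w t o).
Proof. by rewrite wE; case: (state_domain alpha L w0_domain g mu gt (fun k => xi k o)
  t). Qed.

(** The state at [t] is independent of [xi t], so the seed can be integrated out first, with the
    state fixed as in [step_noise_mean]. *)
Lemma mean_step_noise_le0 t : (t < T)%N ->
  summable_rv P (fun o => step_noise alpha L w0 g mu gt (st t o, xi t o)) /\
  mean P (fun o => step_noise alpha L w0 g mu gt (st t o, xi t o)) <= 0.
Proof.
move=> tT; have mst := measurable_state t.
have joint C A (mC : measurable C) (mA : measurable A) :
    (P (st t @^-1` C `&` xi t @^-1` A) = P (st t @^-1` C) * mu A)%E :=
  @chain_independent _ _ _ _ _ _ _ _ _ T xi xi_iid _ st (w0,
    w0) (measurable_step gt_cbb)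
    erefl (fun _ _ => erefl) t C A tT mC mA.
have dom o : domain (st t o).1 /\ domain (st t o).2.
  split; first by rewrite -wE; exact: iterate_domain.
  exact: ghost_state_domain.
pose f := step_noise alpha L w0 g mu gt.
have mf : measurable_fun setT f := measurable_step_noise gt_cbb.
have key o : [/\ summable_rv mu (fun x => f (st t o, x)),
      mean mu (fun x => f (st t o, x)) <= 0,
      summable_rv mu (fun x => `|f (st t o, x)|)
    & mean mu (fun x => `|f (st t o, x)|) <= @step_noise_bound _ m alpha L].
  have [d1 d2] := dom o.
  have := step_noise_mean alpha_gt0 L_gt0 w0_domain gt_cbb d1 d2.
  rewrite -!surjective_pairing; exact.
have [|sf ef] := @integral_independent _ _ _ _ _ _ _ mu P (st t) (xi t) mst
    (measurable_funPT _) joint f (@step_noise_bound _ m alpha L) mf.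
  by move=> o; have [_ _ s1 le1] := key o; rewrite meanE// lee_fin.
(* The inner mean is nonpositive: its positive part integrates to 0, and the negative part only
   lowers the integral. *)
split=> //; rewrite -lee_fin -meanE// ef integralE integral0_eq ?sub0e ?oppe_le0.
  by apply: integral_ge0 => o _; exact: funeneg_ge0.
move=> o _; have [s1 le1 _ _] := key o.
by rewrite funeposE meanE//; apply/max_idPr; rewrite lee_fin.
Qed.

Lemma expected_max_le_iterate :
  expected_max_le P (fun o u =>
    ((T%:R^-1 * \sum_(1 <= t < T.+1) pairing (g (w t o)) (w t o - u))%:E
     - alpha%:E * bregman w0 u)%E) 0.
Proof.
pose G o := T%:R^-1 *: \sum_(1 <= t < T.+1) g (w t o).
pose c o := T%:R^-1 * \sum_(1 <= t < T.+1) pairing (g (w t o)) (w t o).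
pose Y o := \sum_(t < T) step_noise alpha L w0 g mu gt (st t o, xi t o).
have cGE o u : c o - pairing (G o) u
    = T%:R^-1 * \sum_(1 <= t < T.+1) pairing (g (w t o)) (w t o - u).
  rewrite /c /G pairingZl -mulrBr; congr (_ * _).
  under [RHS]eq_bigr do rewrite pairingBr.
  by rewrite sumrB pairing_suml.
have [C bC] := pairing_lipschitz_bounded L_gt0 g_lipschitz w0_domain.
have mw t : measurable_fun setT (fun o => g (w t o)).
  apply: (measurable_lipschitz_op L_gt0 g_lipschitz) => //;
    first exact: measurable_iterate.
  exact: iterate_domain.
have mc : measurable_fun setT c.
  apply: measurable_funM => //; apply: measurable_sum => t.
  by apply: measurable_pairing => //; exact: measurable_iterate.
have mG : measurable_fun setT G.
  apply: measurable_zZ; exact: measurable_z_sum.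
have sY : summable_rv P Y.
  exact: (summable_rv_sum (index_enum 'I_T) (fun t => (mean_step_noise_le0 (ltn_ord
    t)).1)).
have Y0 : mean P Y <= 0.
  rewrite /Y (mean_sum (index_enum 'I_T) (fun t => (mean_step_noise_le0 (ltn_ord
    t)).1)).
  by apply: sumr_le0 => t _; exact: (mean_step_noise_le0 (ltn_ord t)).2.
have kappa0 : 0 < eta * T%:R by rewrite mulr_gt0.
have T4 : 4 <= eta * alpha * T%:R.
  by have := T_large; rewrite ler_pdivrMr; [rewrite mulrC|exact: mulr_gt0].
have bcG o u : domain u -> `|c o - pairing (G o) u| <= C.
  move=> du; rewrite cGE normrM gtr0_norm ?invr_gt0// mulrC ler_pdivrMr//.
  apply: (le_trans (ler_norm_sum _ _ _)).
  rewrite big_add1/= big_mkord mulr_natr -[X in _ *+ X]card_ord -sumr_const.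
  apply: ler_sum => t _; apply: bC => //; exact: iterate_domain.
have le_Y o u : domain u -> dominated w0 u ->
    eta * T%:R * (c o - pairing (G o) u - alpha * rbregman w0 u) <= Y o.
  move=> du wu.
  have := regret_step_noise alpha_gt0 L_gt0 w0_domain gt_cbb (fun k => xi k o) T4 du wu.
  rewrite -/eta -/(Y o) cGE; apply: le_trans.
  rewrite le_eqVlt; apply/orP; left; apply/eqP.
  under [in RHS]eq_bigr => t _ do rewrite -/(st t o) -wE.
  by field; rewrite gt_eqF.
have := expected_max_le_linear alpha_gt0 kappa0 w0_domain mc mG bcG sY Y0 le_Y.
by congr (expected_max_le P _ 0); apply/funext => o; apply/funext => u; rewrite cGE.
Qed.

(** Skew-symmetry gives [pairing (lin z) z = 0], so [pairing (g z) (z - u)] is linear in [z] on the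
    domain, and its value at the average is the average of its values. *)
Lemma relaxed_proximal_average (A : 'M[R]_(m, n)) :
  (forall z, domain z -> g z = (A^T *m z.2, - (A *m z.1))) ->
  relaxed_proximal_output P alpha 0 g w0
    (fun o => T%:R^-1 *: \sum_(1 <= t < T.+1) w t o).
Proof.
move=> gA; have T0 : (0 < T)%N by rewrite -(ltr0n R).
have dwb o : domain (T%:R^-1 *: \sum_(1 <= t < T.+1) w t o).
  exact: (domain_average T0 (fun t => iterate_domain t o)).
split=> //.
  apply: measurable_zZ; apply: measurable_z_sum => t; exact: measurable_iterate.
have := expected_max_le_iterate.
congr (expected_max_le P _ 0); apply/funext => o; apply/funext => u.
congr (_%:E - _)%E.
pose lin (z : zspace R n m) : zspace R n m := (A^T *m z.2, - (A *m z.1)).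
have skew z : pairing (lin z) z = 0.
  rewrite /pairing /dot /=.
  under eq_bigr do rewrite mxE mulr_suml.
  rewrite exchange_big -big_split/= big1// => j _.
  rewrite !mxE mulNr mulr_suml -sumrB big1// => i _.
  by rewrite !mxE; ring.
have linD z z' : lin (z + z') = lin z + lin z'.
  by rewrite /lin /= !mulmxDr opprD.
have linZ (k : R) z : lin (k *: z) = k *: lin z.
  by rewrite /lin /= -!scalemxAr -scalerN.
have gl z : domain z -> pairing (g z) (z - u) = - pairing (lin z) u.
  by move=> dz; rewrite gA// pairingBr skew sub0r.
rewrite gl// linZ pairingZl -mulrN; congr (_ * _).
rewrite (eq_bigr (fun t => - pairing (lin (w t o)) u)); last first.
  by move=> t _; rewrite gl//; exact: iterate_domain.
rewrite sumrN -pairing_suml; congr (- pairing _ _).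
elim/big_ind2: _ => // [|z z' v v' -> ->]; last by rewrite linD.
by rewrite -(scale0r (0 : zspace R n m)) linZ !scale0r.
Qed.
End iterates.

Theorem proposition3 (R : realType) (n m : nat)
    (alpha L : R) (alpha_gt0 : 0 < alpha) (L_gt0 : 0 < L)
    (w0 : zspace R n m) (w0_domain : domain w0)
    (g : zspace R n m -> zspace R n m)
    (g_monotone : monotone_op g) (g_lipschitz : lipschitz_op L g)
    (d : measure_display) (S : measurableType d) (mu : probability S R)
    (gt : zspace R n m -> S -> zspace R n m)
    (gt_cbb : centered_bounded_biased mu w0 L (24 * L ^+ 2 / alpha) g gt)
    (eta : R) (eta_def : eta = alpha / (24 * L ^+ 2))
    (T : nat) (T_large : 4 / (eta * alpha) <= T%:R)
    (d' : measure_display) (Omega : measurableType d')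
    (P : probability Omega R)
    (xi : nat -> {RV P >-> S}) (xi_iid : iid_seeds mu T xi) :
  let w t omega := iterate gt alpha eta w0 (fun k => xi k omega) t in
  expected_max_le P (fun omega u =>
    ((T%:R^-1 * \sum_(1 <= t < T.+1) pairing (g (w t omega)) (w t omega - u))%:E
     - alpha%:E * bregman w0 u)%E) 0
  /\
  (forall A : 'M[R]_(m, n),
     (forall z, domain z -> g z = (A^T *m z.2, - (A *m z.1))) ->
     relaxed_proximal_output P alpha 0 g w0
       (fun omega => T%:R^-1 *: \sum_(1 <= t < T.+1) w t omega)).
Proof.
move: T_large; rewrite eta_def => T_large' w; split.
  exact: (expected_max_le_iterate alpha_gt0 L_gt0 w0_domain g_lipschitz gt_cbb T_large' xi_iid).
exact: (relaxed_proximal_average alpha_gt0 L_gt0 w0_domain g_lipschitz gt_cbb T_large' xi_iid).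
Qed.
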